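(* Let $T$ be an aperiodic and repetitive tiling of $\mathbb{R}^d$ with finite local complexity (FLC). Then the tiling groupoid $R_{\mathrm{punc}}$ is almost finite. Furthermore, the subsets $F_j^{(i)}$ in the definition of the fundamental domain of the elementary subgroupoid can be chosen to be arbitrarily small in diameter: for every compact $C\subset R_{\mathrm{punc}}$, every $\epsilon>0$ and every $\eta>0$ there is a $(C,\epsilon)$-invariant elementary subgroupoid of $R_{\mathrm{punc}}$ with a fundamental domain whose associated sets $F_j^{(i)}\subset\Omega_{\mathrm{punc}}$ all have diameter less than $\eta$.
   Context: Tilings. A prototile is a labelled subset of $\mathbb{R}^d$ homeomorphic to the closed unit ball; a prototile set $\mathcal{P}$ is a finite set of prototiles (equal subsets with different labels count as different prototiles). A tiling $T$ with prototile set $\mathcal{P}$ is a set $\{t_1,t_2,\ldots\}$ of (labelled) subsets of $\mathbb{R}^d$, called tiles, such that each $t_i=p_i+x_i$ for some $p_i\in\mathcal{P}$, $x_i\in\mathbb{R}^d$; $\bigcup_i t_i=\mathbb{R}^d$; and $\mathrm{int}(t_i)\cap\mathrm{int}(t_j)=\emptyset$ for $i\ne j$. A patch is a finite connected subset of tiles of a tiling. Put $T\sqcap B_r(x)=\{t\in T: t\cap B_r(x)\neq\emptyset\}$ and $T+x=\{t+x: t\in T\}$. Tiling metric: for $0<\varepsilon<1$, $T_1,T_2\in T+\mathbb{R}^d$ are $\varepsilon$-close if there are $x_1,x_2\in\mathbb{R}^d$ with $\|x_1\|,\|x_2\|\le\varepsilon$ and $(T_1+x_1)\sqcap B_{\varepsilon^{-1}}(0)=(T_2+x_2)\sqcap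 B_{\varepsilon^{-1}}(0)$; $d(T_1,T_2)$ is the infimum of such $\varepsilon$, or $1$ if there is none. The continuous hull $\Omega$ of $T$ is the completion of $T+\mathbb{R}^d$ in $d$; its points are tilings. $T$ has FLC if for every $R>0$ the set $\{T\sqcap B_R(x): x\in\mathbb{R}^d\}$ is finite modulo translation. $T$ is aperiodic if every $T'\in\Omega$ is nonperiodic, i.e. $T'+x=T'$ implies $x=0$. $T$ is repetitive if for every patch $P\subset T$ there is $R>0$ such that for every $x\in\mathbb{R}^d$ a translate of $P$ appears in $T\sqcap B_R(x)$. For each $p\in\mathcal{P}$ fix a point $x(p)$ (the puncture) in the interior of $p$; for a tile $t=p+y$ put $x(t)=x(p)+y$. The discrete (punctured) hull $\Omega_{\mathrm{punc}}$ is the set of $T\in\Omega$ for which the origin is a puncture of some tile of $T$. Let $R_{\mathrm{punc}}=\{(T,T-x(t)): T\in\Omega_{\mathrm{punc}},\ t\in T\}$, a groupoid with $(T,T')^{-1}=(T',T)$, $(T,T')(T',T'')=(T,T'')$, $r(T,T')=T$, $s(T,T')=T'$, unit space $\Omega_{\mathrm{punc}}$ (with the metric $d$), and topology from the metric $d_R((T_1,T_1-x(t_1)),(T_2,T_2-x(t_2)))=d(T_1,T_2)+\|x(t_1)-x(t_2)\|$; it is a principal étale groupoid. Almost finiteness. For a groupoid $G$ and $A,B\subset G$, $u\in G^{(0)}$: $AB=\{ab:a\in A,b\in B,s(a)=r(b)\}$, $Au=\{a\in A:s(a)=u\}$; a $G$-set is a subset on which $r$ and $s$ are injective. For compact $C,A\subset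 G$ (with $G$ étale) $A$ is $(C,\epsilon)$-invariant if $|CAu\setminus Au|/|Au|<\epsilon$ for every $u\in G^{(0)}$. A compact Hausdorff étale groupoid $K$ admits a fundamental domain if there are $n\in\mathbb{N}$, $N_1,\dots,N_n\in\mathbb{N}$ and pairwise disjoint clopen sets $F^{(i)}_j\subset K^{(0)}$ ($1\le i\le n$, $1\le j\le N_i$) such that $K^{(0)}=\bigsqcup_{i}\bigsqcup_{j}F_j^{(i)}$; for each $i$ and $1\le j,k\le N_i$ there is a unique compact open $K$-set $V^{(i)}_{j,k}$ with $r(V^{(i)}_{j,k})=F^{(i)}_j$ and $s(V^{(i)}_{j,k})=F^{(i)}_k$; and $K=\bigsqcup_i\bigsqcup_{1\le j,k\le N_i}V^{(i)}_{j,k}$ (the fundamental domain is $F=\bigsqcup_iF^{(i)}_1$). A compact subgroupoid $K$ of a locally compact Hausdorff étale groupoid $G$ is elementary if $G^{(0)}\subset K$ and $K$ admits a fundamental domain. $G$ is almost finite if (i) the compact open $G$-sets cover $G$, and (ii) for any compact $C\subset G$ and $\epsilon>0$ there is a $(C,\epsilon)$-invariant elementary subgroupoid of $G$. *)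

(* Defs.v *)
From HB Require Import structures.
From mathcomp Require Import all_boot all_order all_algebra.
From mathcomp Require Import finmap.
From mathcomp Require Import all_classical all_reals all_analysis.
From mathcomp Require Import ring lra.

Set Implicit Arguments.
Unset Strict Implicit.
Unset Printing Implicit Defensive.

Import Order.TTheory GRing.Theory Num.Theory.
Import numFieldNormedType.Exports.

Local Open Scope classical_set_scope.
Local Open Scope ring_scope.

Section euclidean.
Context {R : realType} {d : nat}.
Implicit Types (x y z : 'rV[R]_d) (A : set 'rV[R]_d).

(* The library norm on 'rV[R]_d is the sup norm; its topology is the product
   topology, hence the Euclidean one. *)
Definition enorm x : R := Num.sqrt (\sum_i x 0 i ^+ 2).

Definition eball x (r : R) : set 'rV[R]_d := [set z | enorm (z - x) < r].

Lemma sumsq_ge0 x : 0 <= \sum_i x 0 i ^+ 2.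
Proof. by apply: sumr_ge0 => i _; rewrite sqr_ge0. Qed.

Lemma enorm_ge0 x : 0 <= enorm x. Proof. exact: sqrtr_ge0. Qed.

Lemma enorm0 : enorm 0 = 0.
Proof. by rewrite /enorm big1 ?sqrtr0// => i _; rewrite mxE expr0n. Qed.

Lemma enormN x : enorm (- x) = enorm x.
Proof. by congr Num.sqrt; apply: eq_bigr => i _; rewrite mxE sqrrN. Qed.

Lemma enormB x y : enorm (x - y) = enorm (y - x).
Proof. by rewrite -opprB enormN. Qed.

Lemma coord_le_enorm x i : `|x 0 i| <= enorm x.
Proof.
rewrite -sqrtr_sqr ler_wsqrtr// (bigD1 i)//= lerDl.
by apply: sumr_ge0 => j _; rewrite sqr_ge0.
Qed.

Lemma enorm_eq0 x : enorm x = 0 -> x = 0.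
Proof.
move=> x0; apply/rowP => i; rewrite mxE; apply/eqP; rewrite -normr_le0.
by rewrite -x0 coord_le_enorm.
Qed.

Lemma cauchy_schwarz_sum x y :
  (\sum_i x 0 i * y 0 i) ^+ 2 <= (\sum_i x 0 i ^+ 2) * \sum_i y 0 i ^+ 2.
Proof.
have : 0 <= \sum_i \sum_j (x 0 i * y 0 j - x 0 j * y 0 i) ^+ 2.
  by apply: sumr_ge0 => i _; apply: sumr_ge0 => j _; rewrite sqr_ge0.
set a := \sum_i _ ^+ 2; set b := \sum_i y 0 i ^+ 2; set c := \sum_i _ * _.
suff -> : \sum_i \sum_j (x 0 i * y 0 j - x 0 j * y 0 i) ^+ 2
    = a * b + b * a - (c * c) *+ 2 by rewrite expr2 -mulr_natl; lra.
have -> : a * b = \sum_i \sum_j (x 0 i ^+ 2) * (y 0 j ^+ 2).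
  by rewrite /a /b big_distrlr.
have -> : b * a = \sum_i \sum_j (y 0 i ^+ 2) * (x 0 j ^+ 2).
  by rewrite /a /b big_distrlr.
have -> : c * c = \sum_i \sum_j (x 0 i * y 0 i) * (x 0 j * y 0 j).
  by rewrite /c big_distrlr.
rewrite -sumrMnl -sumrN -!big_split/=; apply: eq_bigr => i _.
rewrite -sumrMnl -sumrN -!big_split/=.
by apply: eq_bigr => j _; ring.
Qed.

Lemma enormD x y : enorm (x + y) <= enorm x + enorm y.
Proof.
rewrite -(ler_pXn2r (n := 2))// ?nnegrE ?addr_ge0 ?enorm_ge0//.
rewrite sqrrD !sqr_sqrtr ?sumsq_ge0//.
have -> : \sum_i (x + y) 0 i ^+ 2 = \sum_i x 0 i ^+ 2
    + (\sum_i x 0 i * y 0 i) *+ 2 + \sum_i y 0 i ^+ 2.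
  rewrite -sumrMnl -!big_split/=; apply: eq_bigr => i _.
  by rewrite mxE sqrrD.
rewrite lerD2r lerD2l lerMn2r/= /enorm -sqrtrM ?sumsq_ge0//.
rewrite (le_trans (ler_norm _))// -sqrtr_sqr ler_wsqrtr//.
exact: cauchy_schwarz_sum.
Qed.

Lemma interior_eball A z :
  A^° z <-> exists2 r : R, 0 < r & eball z r `<=` A.
Proof.
split.
  move=> /nbhs_ballP[r /= r0 rA]; exists r => // y yr; apply: rA; split=> // i j.
  rewrite /ball/= (ord1 i) distrC.
  have := coord_le_enorm (y - z) j; rewrite !mxE => /le_lt_trans; exact.
move=> [r r0 rA]; apply/nbhs_ballP; exists (r / d.+1%:R) => /=.
  by rewrite divr_gt0.
move=> y [_ zy]; apply: rA; rewrite /eball/=.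
rewrite -(ltr_pXn2r (n := 2))// ?nnegrE ?enorm_ge0 ?ltW//.
rewrite sqr_sqrtr ?sumsq_ge0//.
have : \sum_i (y - z) 0 i ^+ 2 <= \sum_(i < d) (r / d.+1%:R) ^+ 2.
  apply: ler_sum => i _; rewrite -real_normK ?num_real//.
  rewrite ler_pXn2r ?nnegrE ?divr_ge0 ?(ltW r0)// ltW// !mxE distrC.
  exact: (zy 0 i).
move=> /le_lt_trans; apply; rewrite sumr_const card_ord expr_div_n.
rewrite -mulrnAr -[X in _ < X]mulr1 ltr_pM2l ?exprn_gt0//.
rewrite -[_ *+ d]mulr_natr mulrC ltr_pdivrMr ?exprn_gt0// mul1r.
rewrite -natrX ltr_nat -mulnn mulSn; exact: ltn_addr.
Qed.

End euclidean.

Section tilings.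
Variables (R : realType) (d : nat) (L : Type).
Local Notation point := 'rV[R]_d.

Definition tile : Type := (set point * L)%type.
Implicit Types (t u p q : tile) (T Q : set tile) (x y z v w : point).

Definition translate_tile t x : tile := ([set z + x | z in t.1], t.2).

Definition translate T x : set tile := [set translate_tile t x | t in T].

(* Tiles of T meeting A: the operation written T \sqcap A. *)
Definition meeting T (A : set point) : set tile :=
  [set t | T t /\ t.1 `&` A !=set0].

Definition homeo_closed_ball (A : set point) : Prop :=
  let B := [set z : point | enorm z <= 1] in
  exists f g : point -> point,
    [/\ {within A, continuous f}, {within B, continuous g},
        f @` A `<=` B, g @` B `<=` A &
        (forall a, A a -> g (f a) = a) /\ (forall b, B b -> f (g b) = b)].

Record prototile_set := PrototileSet {
  protos : set tile;
  protos_finite : finite_set protos;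
  protos_ball : forall p, protos p -> homeo_closed_ball p.1 }.

(* A choice of a puncture in the interior of every prototile. The last field
   says precisely that x(p + y) = x(p) + y is well defined when two prototiles
   with the same label are translates of each other; it is automatic if no two
   are. *)
Record puncturing (P : prototile_set) := Puncturing {
  punct :> tile -> point;
  punct_int : forall p, protos P p -> p.1^° (punct p);
  punct_shift : forall p q y, protos P p -> protos P q -> q = translate_tile p y ->
    punct q = punct p + y }.

Definition tile_punct (P : prototile_set) (x : puncturing P) t : point :=
  xget 0 [set z | exists p y, [/\ protos P p, t = translate_tile p y & z = x p + y]].

Definition is_tiling (P : prototile_set) T : Prop :=
  [/\ (forall t, T t -> exists p x, protos P p /\ t = translate_tile p x),
      \bigcup_(t in T) t.1 = setT &
      (forall t u, T t -> T u -> t <> u -> t.1^° `&` u.1^° = set0)].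

Definition eps_close (e : R) T1 T2 : Prop :=
  0 < e < 1 /\ exists x1 x2, [/\ enorm x1 <= e, enorm x2 <= e &
    meeting (translate T1 x1) (eball 0 e^-1) =
    meeting (translate T2 x2) (eball 0 e^-1)].

Definition tdist T1 T2 : R :=
  let E := [set e | eps_close e T1 T2] in
  if `[< E !=set0 >] then inf E else 1.

(* The tilings with prototile set P form a complete metric space for tdist, so
   the completion of the orbit T + R^d, as a space of tilings, is the closure
   of the orbit in that space. *)
Definition hull (P : prototile_set) T : set (set tile) :=
  [set T' | is_tiling P T' /\
            forall e : R, 0 < e -> exists y, tdist T' (translate T y) < e].

Definition FLC T : Prop :=
  forall r : R, 0 < r -> exists2 X : set (set tile), finite_set X &
    forall x, exists Q y, X Q /\ meeting T (eball x r) = translate Q y.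

Definition aperiodic (P : prototile_set) T : Prop :=
  forall T', hull P T' -> forall x, translate T' x = T' -> x = 0.

Definition patch_of T Q : Prop :=
  [/\ Q `<=` T, finite_set Q & connected (\bigcup_(t in Q) t.1)].

Definition repetitive T : Prop :=
  forall Q, patch_of T Q -> exists2 r : R, 0 < r &
    forall x, exists y, translate Q y `<=` meeting T (eball x r).

Lemma translate_tile0 t : translate_tile t 0 = t.
Proof.
case: t => A l; congr pair; rewrite eqEsubset; split => z /=.
  by move=> [y Ay <-]; rewrite addr0.
by move=> Az; exists z => //; rewrite addr0.
Qed.

Lemma translate_tileD t x y : translate_tile (translate_tile t x) y = translate_tile t (x + y).
Proof.
case: t => A l; congr pair; rewrite eqEsubset; split => z /=.
  by move=> [_ [a Aa <-] <-]; exists a => //; rewrite addrA.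
by move=> [a Aa <-]; exists (a + x); [exists a|rewrite addrA].
Qed.

Lemma translate_tileK t x : translate_tile (translate_tile t x) (- x) = t.
Proof. by rewrite translate_tileD subrr translate_tile0. Qed.

Lemma translate_tileP t x z : (translate_tile t x).1 z <-> t.1 (z - x).
Proof.
split=> [[a ta <-]|tz]; first by rewrite addrK.
by exists (z - x) => //; rewrite subrK.
Qed.

Lemma translate0 T : translate T 0 = T.
Proof.
rewrite eqEsubset; split => t /=.
  by move=> [u Tu <-]; rewrite translate_tile0.
by move=> Tt; exists t => //; rewrite translate_tile0.
Qed.

Lemma translateD T x y : translate (translate T x) y = translate T (x + y).
Proof.
rewrite eqEsubset; split => t /=.
  by move=> [_ [u Tu <-] <-]; exists u => //; rewrite translate_tileD.
by move=> [u Tu <-]; exists (translate_tile u x); [exists u|rewrite translate_tileD].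
Qed.

Lemma translateK T x : translate (translate T x) (- x) = T.
Proof. by rewrite translateD subrr translate0. Qed.

Lemma translateP T x t : translate T x t <-> T (translate_tile t (- x)).
Proof.
split=> [[u Tu <-]|Tt]; first by rewrite translate_tileK.
by exists (translate_tile t (- x)) => //; rewrite translate_tileD addNr translate_tile0.
Qed.

Lemma meeting_shift T A x : meeting (translate T x) A =
  translate (meeting T [set z | A (z + x)]) x.
Proof.
rewrite eqEsubset; split => t.
  move=> [/translateP Tt [z [tz Az]]]; apply/translateP; split => //.
  exists (z - x); split; last by rewrite /= subrK.
  by apply/translate_tileP; rewrite opprK subrK.
move=> /translateP[Tt [z [tz Az]]]; split; first exact/translateP.
by exists (z + x); split=> //; move/translate_tileP : tz; rewrite opprK.
Qed.

Lemma meeting_subset T1 T2 (A B : set point) : B `<=` A ->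
  meeting T1 A = meeting T2 A -> meeting T1 B = meeting T2 B.
Proof.
move=> BA TA; rewrite eqEsubset; split => t [Tt [z [tz Bz]]].
  have : meeting T1 A t by split=> //; exists z; split=> //; exact: BA.
  by rewrite TA => -[T2t _]; split=> //; exists z.
have : meeting T2 A t by split=> //; exists z; split=> //; exact: BA.
by rewrite -TA => -[T1t _]; split=> //; exists z.
Qed.

Lemma eps_close_refl e T : 0 < e < 1 -> eps_close e T T.
Proof.
move=> e01; split=> //; exists 0, 0; have /andP[/ltW e0 _] := e01.
by rewrite enorm0.
Qed.

Lemma eps_close_sym e T1 T2 : eps_close e T1 T2 -> eps_close e T2 T1.
Proof. by move=> [e01 [x1 [x2 [? ? ?]]]]; split=> //; exists x2, x1. Qed.

(* Closeness of two tilings moved by x1 + v and x2 + v, on a ball which the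
   translation by v keeps inside the one where x1 and x2 match them. *)
Lemma eps_close_shift_aux e e' T1 T2 x1 x2 v : 0 < e -> 0 < e' ->
  e'^-1 + enorm v <= e^-1 ->
  meeting (translate T1 x1) (eball 0 e^-1) = meeting (translate T2 x2) (eball 0 e^-1) ->
  meeting (translate T1 (x1 + v)) (eball 0 e'^-1) =
  meeting (translate T2 (x2 + v)) (eball 0 e'^-1).
Proof.
move=> e0 e0' le T12; rewrite -!translateD !(meeting_shift (translate _ _) _ v).
congr translate; apply: meeting_subset T12 => z.
rewrite /eball/= !subr0 => zv.
have -> : z = (z + v) - v by rewrite addrK.
rewrite (le_lt_trans (enormD _ _))// enormN (lt_le_trans _ le)//.
by rewrite ltrD2r.
Qed.

Lemma eps_closeW e e' T1 T2 : e <= e' -> e' < 1 ->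
  eps_close e T1 T2 -> eps_close e' T1 T2.
Proof.
move=> ee' e'1 [/andP[e0 e1] [x1 [x2 [h1 h2 h]]]].
have e'0 : 0 < e' by exact: lt_le_trans ee'.
split; first by rewrite e'0.
exists x1, x2; split; [exact: le_trans ee'|exact: le_trans ee'|].
rewrite -[x1]addr0 -[x2]addr0; apply: eps_close_shift_aux h => //.
by rewrite enorm0 addr0 lef_pV2.
Qed.

Lemma eps_close_triangle e e' T1 T2 T3 : e + e' < 1 ->
  eps_close e T1 T2 -> eps_close e' T2 T3 -> eps_close (e + e') T1 T3.
Proof.
move=> ee' [/andP[e0 e1] [x1 [x2 [h1 h2 h]]]].
move=> [/andP[e'0 e'1] [y2 [y3 [k2 k3 k]]]].
have s0 : 0 < e + e' by exact: addr_gt0.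
split; first by rewrite s0.
have inv_le a b v : 0 < a -> 0 < b -> a + b < 1 -> enorm v <= b ->
    (a + b)^-1 + enorm v <= a^-1.
  move=> a0 b0 ab1 vb; apply: (le_trans (lerD (lexx _) vb)).
  have ab0 : 0 < a + b by exact: addr_gt0.
  rewrite -subr_ge0.
  have -> : a^-1 - ((a + b)^-1 + b) = b * (1 - a * (a + b)) / (a * (a + b)).
    by field; rewrite !lt0r_neq0.
  rewrite divr_ge0// ?mulr_ge0// ?(ltW a0) ?(ltW b0) ?(ltW ab0)//.
  by rewrite subr_ge0; nra.
exists (x1 + y2), (y3 + x2); split.
- by rewrite (le_trans (enormD _ _))// lerD.
- by rewrite (le_trans (enormD _ _))// addrC lerD.
- rewrite (@eps_close_shift_aux e (e + e') T1 T2 x1 x2 y2)//; last exact: inv_le.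
  rewrite -(@eps_close_shift_aux e' (e + e') T2 T3 y2 y3 x2)//.
    by rewrite [y2 + _]addrC.
  by rewrite [e + e']addrC inv_le// addrC.
Qed.

Lemma tdist_le e T1 T2 : eps_close e T1 T2 -> tdist T1 T2 <= e.
Proof.
move=> h; rewrite /tdist asboolT; last by exists e.
apply: ge_inf => //; exists 0 => y [/andP[y0 _] _]; exact: ltW.
Qed.

Lemma tdist_ge0 T1 T2 : 0 <= tdist T1 T2.
Proof.
rewrite /tdist; case: asboolP => // E0; apply: lb_le_inf => //.
by move=> y [/andP[y0 _] _]; exact: ltW.
Qed.

Lemma tdist_le1 T1 T2 : tdist T1 T2 <= 1.
Proof.
have [[e h]|h] := pselect ([set e | eps_close e T1 T2] !=set0).
  by apply: (le_trans (tdist_le h)); case: h => /andP[_ /ltW].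
by rewrite /tdist asboolF.
Qed.

Lemma tdist_lt e T1 T2 : e <= 1 -> tdist T1 T2 < e ->
  exists2 e', e' < e & eps_close e' T1 T2.
Proof.
move=> e1; rewrite /tdist; case: asboolP => [E0|_]; last by rewrite ltNge e1.
by move=> /(inf_lt E0)[e' /= h e'e]; exists e'.
Qed.

Lemma tdistxx T : tdist T T = 0.
Proof.
apply/eqP; rewrite eq_le tdist_ge0 andbT; apply/ler_addgt0Pl => e e0.
have h : 0 < Num.min e (2^-1 : R) < 1.
  by rewrite lt_min e0 gt_min invr_gt0 ltr0n invf_lt1 ?ltr1n ?orbT.
rewrite addr0 (le_trans (tdist_le (eps_close_refl T h)))//.
by rewrite ge_min lexx.
Qed.

Lemma tdist_sym T1 T2 : tdist T1 T2 = tdist T2 T1.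
Proof.
rewrite /tdist; have -> // : [set e | eps_close e T1 T2] =
  [set e | eps_close e T2 T1].
by rewrite eqEsubset; split => e; exact: eps_close_sym.
Qed.

Lemma tdist_triangle T2 T1 T3 : tdist T1 T3 <= tdist T1 T2 + tdist T2 T3.
Proof.
have [s1|s1] := leP 1 (tdist T1 T2 + tdist T2 T3).
  exact: le_trans (tdist_le1 _ _) s1.
apply/ler_addgt0Pl => e e0.
pose a := Num.min (e / 2) ((1 - (tdist T1 T2 + tdist T2 T3)) / 2).
have a0 : 0 < a by rewrite lt_min !divr_gt0// subr_gt0.
have a1 : a <= e / 2 by rewrite ge_min lexx.
have a2 : a <= (1 - (tdist T1 T2 + tdist T2 T3)) / 2.
  by rewrite ge_min lexx orbT.
have p12 := tdist_ge0 T1 T2; have p23 := tdist_ge0 T2 T3.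
have [||e1 l1 c1] := @tdist_lt (tdist T1 T2 + a) T1 T2; [lra|lra|].
have [||e2 l2 c2] := @tdist_lt (tdist T2 T3 + a) T2 T3; [lra|lra|].
apply: (le_trans (tdist_le (eps_close_triangle _ c1 c2))); lra.
Qed.

Lemma tile_punctE (P : prototile_set) (x : puncturing P) p y : protos P p ->
  tile_punct x (translate_tile p y) = x p + y.
Proof.
move=> Pp; rewrite /tile_punct; case: xgetP => [z _|/(_ (x p + y))]; last first.
  by case; exists p, y.
move=> [q [w [Pq pq ->]]]; rewrite (@punct_shift _ x p q (y - w))//.
  by rewrite -addrA subrK.
by rewrite -translate_tileD pq translate_tileK.
Qed.

Lemma tile_punct_shift (P : prototile_set) (x : puncturing P) T t v :
  is_tiling P T -> T t -> tile_punct x (translate_tile t v) = tile_punct x t + v.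
Proof.
move=> [h _ _] /h[p [y [Pp ->]]].
by rewrite translate_tileD !tile_punctE// addrA.
Qed.

Lemma interior_shift t v z : (translate_tile t v).1^° z <-> t.1^° (z - v).
Proof.
split=> /interior_eball[r r0 h]; apply/interior_eball; exists r => // y yr.
  have /h/translate_tileP : eball z r (y + v).
    by move: yr; rewrite /eball/= opprB addrA.
  by rewrite addrK.
by apply/translate_tileP/h; move: yr; rewrite /eball/= opprB addrA subrK.
Qed.

Lemma tile_punct_int (P : prototile_set) (x : puncturing P) T t :
  is_tiling P T -> T t -> t.1^° (tile_punct x t).
Proof.
move=> [h _ _] /h[p [y [Pp ->]]]; rewrite tile_punctE//; apply/interior_shift.
by rewrite addrK; exact: punct_int.
Qed.

Lemma is_tiling_shift (P : prototile_set) T v :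
  is_tiling P T -> is_tiling P (translate T v).
Proof.
move=> [tr cov dis]; split.
- by move=> _ [u /tr[p [y [Pp ->]]] <-]; exists p, (y + v); rewrite translate_tileD.
- apply/seteqP; split => // z _.
  have [u Tu uz] : (\bigcup_(t in T) t.1) (z - v) by rewrite cov.
  by exists (translate_tile u v); [exists u|exact/translate_tileP].
- move=> _ _ [t Tt <-] [u Tu <-] tu; apply/seteqP; split => // z.
  move=> [/interior_shift tz /interior_shift uz].
  have : (t.1^° `&` u.1^°) (z - v) by [].
  by rewrite dis// => tu'; apply: tu; rewrite tu'.
Qed.

Lemma tdist0_shift (P : prototile_set) (x : puncturing P) T1 T2 t :
  is_tiling P T1 -> T1 t -> tdist T1 T2 = 0 ->
  forall e : R, 0 < e -> exists2 w, enorm w < e & T2 (translate_tile t w).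
Proof.
move=> t1 Tt d0 e e0; set z := tile_punct x t.
have tz : t.1 z by apply: interior_subset; exact: tile_punct_int t1 Tt.
have nz := enorm_ge0 z.
pose b := Num.min (e / 3) (enorm z + 2)^-1.
have b0 : 0 < b by rewrite lt_min divr_gt0// invr_gt0; lra.
have be : b <= e / 3 by rewrite ge_min lexx.
have bz : b <= (enorm z + 2)^-1 by rewrite ge_min lexx orbT.
have b1 : b <= 1 by rewrite (le_trans bz)// invf_le1; lra.
have [|c cb [/andP[c0 c1] [x1 [x2 [h1 h2 h]]]]] := @tdist_lt b T1 T2 b1.
  by rewrite d0.
exists (x1 - x2).
  by rewrite (le_lt_trans (enormD _ _))// enormN; lra.
have : meeting (translate T1 x1) (eball 0 c^-1) (translate_tile t x1).
  split; first by exists t.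
  exists (z + x1); split; first by apply/translate_tileP; rewrite addrK.
  rewrite /eball/= subr0 (le_lt_trans (enormD _ _))//.
  have : (enorm z + 2) <= c^-1.
    by rewrite -[leLHS]invrK lef_pV2 ?posrE ?invr_gt0//; lra.
  lra.
by rewrite h => -[/translateP + _]; rewrite translate_tileD.
Qed.

Lemma tdist0_subset (P : prototile_set) (x : puncturing P) T1 T2 :
  is_tiling P T1 -> is_tiling P T2 -> tdist T1 T2 = 0 -> T1 `<=` T2.
Proof.
move=> t1 t2 d0 t Tt; have near0 := tdist0_shift x t1 Tt d0.
have /interior_eball[r r0 rt] : t.1^°^° (tile_punct x t).
  by apply: nbhs_interior; exact: tile_punct_int t1 Tt.
have [|w wr T2w] := near0 (r / 2); first by rewrite divr_gt0.
have [w0|w0] := eqVneq w 0; first by rewrite -(translate_tile0 t) -w0.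
have nw0 : 0 < enorm w.
  by rewrite lt0r enorm_ge0 andbT; apply: contra_neq w0; exact: enorm_eq0.
have [w' w'w T2w'] := near0 _ nw0.
suff ww' : translate_tile t w = translate_tile t w'.
  have := tile_punct_shift x w t1 Tt; rewrite ww' (tile_punct_shift x w' t1 Tt).
  by move=> /addrI w'E; move: w'w; rewrite w'E ltxx.
apply: contrapT => ww'; have [_ _ dis] := t2.
have : ((translate_tile t w).1^° `&` (translate_tile t w').1^°) (tile_punct x t + w).
  split; apply/interior_shift; first by rewrite addrK; exact: tile_punct_int t1 Tt.
  apply: rt; rewrite /eball/= -(addrA _ w) [_ + (w - _)]addrC addrK.
  by rewrite (le_lt_trans (enormD _ _))// enormN; lra.
by rewrite dis.
Qed.

Lemma tdist0_eq (P : prototile_set) (x : puncturing P) T1 T2 :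
  is_tiling P T1 -> is_tiling P T2 -> tdist T1 T2 = 0 -> T1 = T2.
Proof.
move=> t1 t2 d0; apply/seteqP; split => t Tt.
  exact: (tdist0_subset x t1 t2 d0 Tt).
by apply: (tdist0_subset x t2 t1 _ Tt); rewrite tdist_sym.
Qed.

Lemma hull_shift (P : prototile_set) T T' v :
  hull P T T' -> hull P T (translate T' v).
Proof.
move=> [tT' h]; split; first exact: is_tiling_shift.
move=> e e0; have nv := enorm_ge0 v.
pose a := Num.min e 1 / 2.
have a0 : 0 < a by rewrite divr_gt0// lt_min e0 ltr01.
have ae : a < e.
  by rewrite /a ltr_pdivrMr// (@le_lt_trans _ _ e) ?ge_min ?lexx//; lra.
have a1 : a < 1.
  by rewrite /a ltr_pdivrMr// mul1r (@le_lt_trans _ _ 1) ?ge_min ?lexx ?orbT//; lra.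
pose b := (a^-1 + enorm v)^-1.
have b0 : 0 < b by rewrite invr_gt0 ltr_wpDr// invr_gt0.
have ba : b <= a.
  by rewrite -[leRHS]invrK lef_pV2 ?posrE ?invr_gt0// ?lerDl// ltr_wpDr// invr_gt0.
have [y yb] := h b b0; exists (y + v).
have [|c cb [/andP[c0 c1] [x1 [x2 [h1 h2 h12]]]]] := tdist_lt _ yb.
  exact: le_trans ba (ltW a1).
apply: (le_lt_trans _ ae); apply: tdist_le; split; first by rewrite a0.
exists x1, x2; split.
- by rewrite (le_trans h1)// (le_trans (ltW cb)).
- by rewrite (le_trans h2)// (le_trans (ltW cb)).
- rewrite (translateD T' v) -(translateD T y v) (translateD (translate T y) v) ![v + _]addrC.
  apply: eps_close_shift_aux h12 => //.
  by rewrite -[leLHS]invrK -/b lef_pV2 ?posrE// ltW.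
Qed.

End tilings.

(* The algebraic part of a groupoid, with a topology on the set of arrows and on
   the set of units; the composite gmul a b is meaningful when src a = rng b. *)
Record groupoid := Groupoid {
  arr :> topologicalType;
  obj : topologicalType;
  rng : arr -> obj;
  src : arr -> obj;
  idt : obj -> arr;
  gmul : arr -> arr -> arr;
  ginv : arr -> arr;
  rng_idt : forall u, rng (idt u) = u;
  src_idt : forall u, src (idt u) = u;
  rng_inv : forall a, rng (ginv a) = src a;
  src_inv : forall a, src (ginv a) = rng a;
  rng_mul : forall a b, src a = rng b -> rng (gmul a b) = rng a;
  src_mul : forall a b, src a = rng b -> src (gmul a b) = src b;
  mul_assoc : forall a b c, src a = rng b -> src b = rng c ->
    gmul a (gmul b c) = gmul (gmul a b) c;
  mul_idl : forall a, gmul (idt (rng a)) a = a;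
  mul_idr : forall a, gmul a (idt (src a)) = a;
  mul_invr : forall a, gmul a (ginv a) = idt (rng a);
  mul_invl : forall a, gmul (ginv a) a = idt (src a) }.

Section groupoids.
Variable G : groupoid.
Implicit Types (A B C K W : set G) (u : obj G).

Definition gset A : Prop := set_inj A (@rng G) /\ set_inj A (@src G).

Definition setM A B : set G :=
  [set c | exists a b, [/\ A a, B b, src a = rng b & c = gmul a b]].

Definition fiber A u : set G := [set a | A a /\ src a = u].

(* fset_set is junk on infinite sets and division by zero is zero, whence the
   side conditions. *)
Definition almost_invariant (R : realType) C (e : R) A : Prop :=
  forall u, let Au := fiber A u in let D := fiber (setM C A) u `\` Au in
  [/\ finite_set Au, Au !=set0, finite_set D &
      (#|` fset_set D|)%:R / (#|` fset_set Au|)%:R < e].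

Definition subgroupoid K : Prop :=
  (forall a b, K a -> K b -> src a = rng b -> K (gmul a b)) /\
  (forall a, K a -> K (ginv a)).

Definition gunits K : set (obj G) := [set u | K (idt u)].

(* K, a subgroupoid with the subspace topology, is an etale topological
   groupoid: continuous operations and a range map which is a local
   homeomorphism onto the unit space. *)
Definition etale K : Prop :=
  [/\ {within K, continuous (@rng G)},
      {within K, continuous (@src G)},
      {within K, continuous (@ginv G)},
      {within [set ab : G * G | [/\ K ab.1, K ab.2 & src ab.1 = rng ab.2]],
        continuous (fun ab => gmul ab.1 ab.2)} &
      forall a, K a -> exists U : set G,
        [/\ U a, U `<=` K, open (U : set (subspace K)), set_inj U (@rng G) &
            forall W, W `<=` U -> open (W : set (subspace K)) ->
              open (@rng G @` W : set (subspace (gunits K)))]].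

Definition compact_open_bisection K (E F : set (obj G)) W : Prop :=
  [/\ W `<=` K, compact W, open (W : set (subspace K)), gset W &
      @rng G @` W = E /\ @src G @` W = F].

(* The sets F_j^(i) of a fundamental domain of K, indexed from 0. *)
Definition fundamental_domain K (n : nat) (N : 'I_n -> nat)
    (F : forall i, 'I_(N i) -> set (obj G)) : Prop :=
  [/\ forall i, (0 < N i)%N,
      forall i j, F i j `<=` gunits K /\
                  clopen (F i j : set (subspace (gunits K))),
      trivIset setT (fun s : {i & 'I_(N i)} => F (tag s) (tagged s)),
      \bigcup_i \bigcup_j F i j = gunits K &
      exists V : forall i, 'I_(N i) -> 'I_(N i) -> set G,
        [/\ forall i j k,
              unique (compact_open_bisection K (F i j) (F i k)) (V i j k),
            trivIset setT (fun s : {i & ('I_(N i) * 'I_(N i))%type} =>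
              V (tag s) (tagged s).1 (tagged s).2) &
            \bigcup_i \bigcup_j \bigcup_k V i j k = K]].

Definition elementary K : Prop :=
  [/\ subgroupoid K, compact K, hausdorff_space (subspace K), etale K &
      gunits K = setT /\
      exists n (N : 'I_n -> nat) (F : forall i, 'I_(N i) -> set (obj G)),
        fundamental_domain K F].

(* The notion is meant for locally compact Hausdorff etale groupoids; these
   standing assumptions on G are not part of the predicate. *)
Definition almost_finite (R : realType) : Prop :=
  (forall a : G, exists W, [/\ compact W, open W, gset W & W a]) /\
  (forall C (e : R), compact C -> 0 < e ->
     exists K, elementary K /\ almost_invariant C e K).

End groupoids.

Definition diam (R : realType) (M : metricType R) (A : set M) : R :=
  sup [set mdist x y | x in A & y in A].

Section tiling_groupoid.
Variables (R : realType) (d : nat) (L : Type).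
Variables (P : prototile_set R d L) (x : puncturing P) (T : set (tile R d L)).

Record punctured_hull := PuncturedHull {
  ptiling : set (tile R d L);
  ptilingP : hull P T ptiling /\ exists2 t, ptiling t & tile_punct x t = 0 }.

Lemma ptiling_inj : injective ptiling.
Proof.
move=> [A hA] [B hB] /= AB; move: AB hA hB => -> hA hB.
by congr PuncturedHull; exact: Prop_irrelevance.
Qed.

HB.instance Definition _ := gen_eqMixin punctured_hull.
HB.instance Definition _ := gen_choiceMixin punctured_hull.

Lemma ptiling_tiling (u : punctured_hull) : is_tiling P (ptiling u).
Proof. by case: (ptilingP u) => -[]. Qed.

Definition hull_dist (u v : punctured_hull) : R := tdist (ptiling u) (ptiling v).

Lemma hull_distxx u : hull_dist u u = 0. Proof. exact: tdistxx. Qed.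

Lemma hull_dist_eq0 u v : hull_dist u v = 0 -> u = v.
Proof.
by move=> /(tdist0_eq x (ptiling_tiling u) (ptiling_tiling v)) /ptiling_inj.
Qed.

Lemma hull_dist_sym u v : hull_dist u v = hull_dist v u.
Proof. exact: tdist_sym. Qed.

Lemma hull_dist_triangle v u w : hull_dist u w <= hull_dist u v + hull_dist v w.
Proof. exact: tdist_triangle. Qed.

HB.instance Definition _ := isMetric.Build R punctured_hull
  hull_distxx hull_dist_eq0 hull_dist_sym hull_dist_triangle.

Definition displaced (u v : punctured_hull) (y : 'rV[R]_d) : Prop :=
  exists t, [/\ ptiling u t, y = tile_punct x t &
                ptiling v = translate (ptiling u) (- y)].

(* The pairs (T', T' - x(t)), with t a tile of T'. *)
Record rpunc := RPunc {
  rpunc_rng : punctured_hull;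
  rpunc_src : punctured_hull;
  rpuncP : exists y, displaced rpunc_rng rpunc_src y }.

Lemma rpunc_eq (a b : rpunc) :
  rpunc_rng a = rpunc_rng b -> rpunc_src a = rpunc_src b -> a = b.
Proof.
case: a b => [u v h] [u' v' h'] /= uu' vv'; move: uu' vv' h h' => -> -> h h'.
by congr RPunc; exact: Prop_irrelevance.
Qed.

HB.instance Definition _ := gen_eqMixin rpunc.
HB.instance Definition _ := gen_choiceMixin rpunc.

(* The vector x(t) of the pair (T', T' - x(t)): it is determined by the pair when
   no tiling of the hull is periodic. *)
Definition displacement (a : rpunc) : 'rV[R]_d :=
  xget 0 (displaced (rpunc_rng a) (rpunc_src a)).

Lemma displacementP a : displaced (rpunc_rng a) (rpunc_src a) (displacement a).
Proof. by have [y ay] := rpuncP a; apply: xgetPex; exists y. Qed.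

Definition rpunc_dist (a b : rpunc) : R :=
  hull_dist (rpunc_rng a) (rpunc_rng b)
  + enorm (displacement a - displacement b).

Lemma rpunc_distxx a : rpunc_dist a a = 0.
Proof. by rewrite /rpunc_dist hull_distxx subrr enorm0 addr0. Qed.

Lemma rpunc_dist_eq0 a b : rpunc_dist a b = 0 -> a = b.
Proof.
move=> /eqP; rewrite /rpunc_dist paddr_eq0 ?enorm_ge0 ?tdist_ge0//.
move=> /andP[/eqP/hull_dist_eq0 rab /eqP/enorm_eq0/eqP].
rewrite subr_eq0 => /eqP dab; apply: rpunc_eq => //; apply: ptiling_inj.
have [t [_ _ ->]] := displacementP a; have [t' [_ _ ->]] := displacementP b.
by rewrite rab dab.
Qed.

Lemma rpunc_dist_sym a b : rpunc_dist a b = rpunc_dist b a.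
Proof. by rewrite /rpunc_dist hull_dist_sym enormB. Qed.

Lemma rpunc_dist_triangle b a c :
  rpunc_dist a c <= rpunc_dist a b + rpunc_dist b c.
Proof.
rewrite /rpunc_dist addrACA lerD ?hull_dist_triangle//.
rewrite (_ : displacement a - displacement c = (displacement a - displacement b)
  + (displacement b - displacement c)) ?enormD//.
by rewrite addrA subrK.
Qed.

HB.instance Definition _ := isMetric.Build R rpunc
  rpunc_distxx rpunc_dist_eq0 rpunc_dist_sym rpunc_dist_triangle.

Lemma displaced0 u : displaced u u 0.
Proof.
have [_ [t ut t0]] := ptilingP u; exists t; split=> //.
by rewrite oppr0 translate0.
Qed.

Lemma displacedN u v y : displaced u v y -> displaced v u (- y).
Proof.
move=> [t [ut _ vE]]; have [_ [t0 ut0 t00]] := ptilingP u.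
exists (translate_tile t0 (- y)); split; first by rewrite vE; exists t0.
  by rewrite (tile_punct_shift _ _ (ptiling_tiling u) ut0) t00 add0r.
by rewrite vE translateD opprK addNr translate0.
Qed.

Lemma displacedD u v w y z :
  displaced u v y -> displaced v w z -> displaced u w (y + z).
Proof.
move=> [t [ut _ vE]] [s [vs zE wE]].
move: (vs); rewrite vE => /translateP; rewrite opprK => us.
exists (translate_tile s y); split=> //.
  by rewrite (tile_punct_shift _ _ (ptiling_tiling v) vs) -zE addrC.
by rewrite wE vE translateD opprD.
Qed.

Definition rpunc_idt u : rpunc := RPunc (ex_intro _ 0 (displaced0 u)).

Lemma rpunc_inv_subproof a :
  exists y, displaced (rpunc_src a) (rpunc_rng a) y.
Proof. by have [y /displacedN] := rpuncP a; exists (- y). Qed.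

Definition rpunc_inv a : rpunc := RPunc (rpunc_inv_subproof a).

Lemma rpunc_mul_subproof a b : rpunc_src a = rpunc_rng b ->
  exists y, displaced (rpunc_rng a) (rpunc_src b) y.
Proof.
have [y ay] := rpuncP a; have [z bz] := rpuncP b => ab.
by exists (y + z); apply: displacedD ay _; rewrite ab.
Qed.

(* On non composable pairs the value is the junk a. *)
Definition rpunc_mul a b : rpunc :=
  if pselect (rpunc_src a = rpunc_rng b) is left ab
  then RPunc (rpunc_mul_subproof ab) else a.

Lemma rpunc_mulP a b : rpunc_src a = rpunc_rng b ->
  rpunc_rng (rpunc_mul a b) = rpunc_rng a /\
  rpunc_src (rpunc_mul a b) = rpunc_src b.
Proof. by move=> ab; rewrite /rpunc_mul; case: pselect. Qed.

Lemma rpunc_mulA a b c : rpunc_src a = rpunc_rng b -> rpunc_src b = rpunc_rng c ->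
  rpunc_mul a (rpunc_mul b c) = rpunc_mul (rpunc_mul a b) c.
Proof.
move=> ab bc; have [ab1 ab2] := rpunc_mulP ab; have [bc1 bc2] := rpunc_mulP bc.
have [|l1 l2] := @rpunc_mulP a (rpunc_mul b c); first by rewrite bc1.
have [|r1 r2] := @rpunc_mulP (rpunc_mul a b) c; first by rewrite ab2.
by apply: rpunc_eq; rewrite ?l1 ?l2 ?r1 ?r2.
Qed.

Lemma rpunc_mul1l a : rpunc_mul (rpunc_idt (rpunc_rng a)) a = a.
Proof. by have [//|? ?] := @rpunc_mulP (rpunc_idt (rpunc_rng a)) a; exact: rpunc_eq. Qed.

Lemma rpunc_mul1r a : rpunc_mul a (rpunc_idt (rpunc_src a)) = a.
Proof. by have [//|? ?] := @rpunc_mulP a (rpunc_idt (rpunc_src a)); exact: rpunc_eq. Qed.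

Lemma rpunc_mulV a : rpunc_mul a (rpunc_inv a) = rpunc_idt (rpunc_rng a).
Proof. by have [//|? ?] := @rpunc_mulP a (rpunc_inv a); exact: rpunc_eq. Qed.

Lemma rpunc_mulVl a : rpunc_mul (rpunc_inv a) a = rpunc_idt (rpunc_src a).
Proof. by have [//|? ?] := @rpunc_mulP (rpunc_inv a) a; exact: rpunc_eq. Qed.

Definition Rpunc : groupoid :=
  @Groupoid rpunc punctured_hull rpunc_rng rpunc_src rpunc_idt rpunc_mul rpunc_inv
    (fun=> erefl) (fun=> erefl) (fun=> erefl) (fun=> erefl)
    (fun _ _ ab => (rpunc_mulP ab).1) (fun _ _ ab => (rpunc_mulP ab).2)
    rpunc_mulA rpunc_mul1l rpunc_mul1r rpunc_mulV rpunc_mulVl.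

End tiling_groupoid.

(* Main.v *)
Require Import Defs.
From mathcomp Require Import all_boot all_order all_algebra.
From mathcomp Require Import finmap.
From mathcomp Require Import all_classical all_reals all_analysis.
From mathcomp Require Import ring lra.

(** An arrow of the tiling groupoid is a tiling u punctured at the origin
    together with another puncture y of u; it goes from u - y to u. Two tilings
    of the punctured hull are close exactly when they agree on a large ball
    about the origin, so everything that can be read off a ball of fixed radius
    is locally constant, and finite local complexity makes the hull compact
    ([hull_compact]).

    The elementary subgroupoid is the relation of lying in the same cell of a
    Voronoi tessellation attached to every tiling of the hull. Its centres are
    produced by a greedy selection among the punctures. Because no tiling of the
    hull has a period, compactness gives a radius s such that two distinct
    punctures of the same tiling at distance less than b never see the same
    patch of radius s ([no_short_return]). Going through the finitely many
    patches of radius s one after the other, and adding each time the punctures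
    which see that patch and are at distance at least b from those chosen
    before, one obtains a set which is b-separated and b-dense, commutes with
    translations and is determined by a patch of bounded radius ([centres]).

    Let c u be the vector from the origin to the centre of the cell of the
    origin in u. The arrow (u, y) joins two points of one cell when
    c u = c (u - y) + y. As c is bounded and locally constant, this defines a
    compact open subgroupoid ([same_cell]). Sorting the tilings by the patch of
    radius S around the centre c u, and then by c u, cuts the unit space into
    the sets of a fundamental domain
    ([same_cell_fundamental_domain]); two tilings in one such set agree on the
    ball of radius S - b, so a large S makes the diameters small ([box_diam]).

    Invariance compares, in one tessellation, the number of punctures outside a
    cell but near it with the number of punctures inside ([voronoi_layers]).
    A cell is convex and contains a large ball about its centre p. Hence the
    homotheties of centre p and ratios 1 - k delta, for k = 1, ..., K, push the
    punctures near the boundary well inside the cell, where a puncture can be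
    found close to the image. For different k the punctures obtained are
    different: otherwise one boundary puncture would lie close to the image of
    another one under a homothety of centre p and ratio less than 1, that is
    inside the cell. For one k, boundary punctures leading to the same puncture
    of the cell are close to each other, and there is a bounded number of these.
    So K times the boundary is at most a constant times the cell
    ([card_boundary]), where K grows with the size of the cells and the constant
    does not. *)

Set Implicit Arguments.
Unset Strict Implicit.
Unset Printing Implicit Defensive.

Import Order.TTheory GRing.Theory Num.Theory.
Import numFieldNormedType.Exports.

Local Open Scope classical_set_scope.
Local Open Scope ring_scope.

(** * Convex cells and counting *)

Lemma finite_set_inj {T U : Type} (A : set T) (B : set U) (f : T -> U) :
  set_inj A f -> f @` A `<=` B -> finite_set B -> finite_set A.
Proof.
move=> /inj_card_eq fA AB /(sub_finite_set AB); by rewrite (eq_finite_set fA).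
Qed.

(** The pairs (b, k) inject into the pairs of an element of S and a colour. *)
Lemma card_boundary (X Y : choiceType) (I : finType) (B : set X) (S : set Y)
    (K : nat) (f : X -> nat -> Y) (col : X -> I) :
  finite_set B -> finite_set S ->
  (forall b k, B b -> (k < K)%N -> S (f b k)) ->
  (forall b b' k k', B b -> B b' -> (k < K)%N -> (k' < K)%N ->
    f b k = f b' k' -> col b = col b' -> b = b' /\ k = k') ->
  (#|` fset_set B| * K <= #|` fset_set S| * #|I|)%N.
Proof.
move=> fB fS fBS finj.
pose s1 := [seq (f b k, col b) | b <- enum_fset (fset_set B), k <- iota 0 K].
pose s2 := [seq (y, i) | y <- enum_fset (fset_set S), i <- enum I].
have -> : (#|` fset_set B| * K = size s1)%N by rewrite size_allpairs size_iota.
have -> : (#|` fset_set S| * #|I| = size s2)%N by rewrite size_allpairs cardE.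
have memB b : b \in enum_fset (fset_set B) -> B b.
  by move=> bB; have : b \in fset_set B by []; rewrite in_fset_set// inE.
apply: uniq_leq_size.
  apply: allpairs_uniq; rewrite ?iota_uniq ?fset_uniq//.
  move=> [b k] [b' k'] /allpairsP[[b1 k1] /= [b1B k1K [-> ->]]].
  move=> /allpairsP[[b2 k2] /= [b2B k2K [-> ->]]] [ff cc].
  move: k1K k2K; rewrite !mem_iota !add0n => /andP[_ k1K] /andP[_ k2K].
  by have [-> ->] := finj _ _ _ _ (memB _ b1B) (memB _ b2B) k1K k2K ff cc.
move=> _ /allpairsP[[b k] /= [bB kK ->]]; apply/allpairsP.
exists (f b k, col b); split=> //=; last by rewrite mem_enum.
move: kK; rewrite mem_iota add0n => /andP[_ kK].
suff : f b k \in fset_set S by [].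
by rewrite in_fset_set// inE; apply: fBS => //; exact: memB.
Qed.

Section geometry.
Context {R : realType} {d : nat}.
Local Notation point := 'rV[R]_d.
Implicit Types (x y z p q v w : point).

Lemma enorm_gt0 z : z <> 0 -> 0 < enorm z.
Proof.
move=> z0; rewrite lt0r enorm_ge0 andbT; apply/eqP => h; exact/z0/enorm_eq0.
Qed.

Lemma enormZ (a : R) z : enorm (a *: z) = `|a| * enorm z.
Proof.
rewrite /enorm -sqrtr_sqr -sqrtrM ?sqr_ge0//; congr Num.sqrt.
by rewrite mulr_sumr; apply: eq_bigr => i _; rewrite mxE exprMn.
Qed.

Lemma enorm_lt_coords (r : R) w : 0 < r ->
  (forall i, `|w 0 i| <= r / d.+1%:R) -> enorm w < r.
Proof.
move=> r0 h; rewrite -(ltr_pXn2r (n := 2))// ?nnegrE ?enorm_ge0 ?ltW//.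
rewrite sqr_sqrtr ?sumsq_ge0//.
have : \sum_i w 0 i ^+ 2 <= \sum_(i < d) (r / d.+1%:R) ^+ 2.
  apply: ler_sum => i _; rewrite -real_normK ?num_real//.
  by rewrite ler_pXn2r ?nnegrE ?divr_ge0 ?(ltW r0).
move=> /le_lt_trans; apply; rewrite sumr_const card_ord expr_div_n.
rewrite -mulrnAr -[X in _ < X]mulr1 ltr_pM2l ?exprn_gt0//.
rewrite -[_ *+ d]mulr_natr mulrC ltr_pdivrMr ?exprn_gt0// mul1r.
rewrite -natrX ltr_nat -mulnn mulSn; exact: ltn_addr.
Qed.

(** Colours are the cells of a cubic grid of mesh r / (d + 1), taken modulo m
    in every coordinate. Points within distance s lie in cells whose
    coordinates differ by less than m, so equal colours force the same cell.
    This is the only packing bound needed: a colour class meets a ball of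
    diameter s in points closer than r. *)
Lemma grid_colouring (s r : R) : 0 < r -> exists (I : finType) (col : point -> I),
  forall z z', enorm (z - z') <= s -> col z = col z' -> enorm (z - z') < r.
Proof.
move=> r0; pose h := r / d.+1%:R; have h0 : 0 < h by rewrite divr_gt0.
pose m := (Num.truncn (`|s| / h)).+2.
pose c (a : R) : 'I_m := inord `|(Num.floor (a / h) %% m%:Z)%Z|%N.
exists {ffun 'I_d -> 'I_m}, (fun z => [ffun i => c (z 0 i)]) => z z' zs /ffunP zz'.
apply: enorm_lt_coords => // i; have := zz' i; rewrite !ffunE => /(congr1 val).
set a := Num.floor (z 0 i / h); set b := Num.floor (z' 0 i / h).
have m0 : m%:Z != 0 by [].
have modm (k : int) : (`|(k %% m%:Z)%Z| < m)%N.
  rewrite -ltz_nat gez0_abs ?modz_ge0//; exact: ltz_pmod.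
rewrite /= !inordK ?modm// => /(congr1 Posz); rewrite !gez0_abs ?modz_ge0//.
move=> /eqP; rewrite eqz_mod_dvd => mab.
have /andP[a1 a2] := floor_itv (z 0 i / h).
have /andP[b1 b2] := floor_itv (z' 0 i / h).
have zi : `|z 0 i / h - z' 0 i / h| <= `|s| / h.
  rewrite -mulrBl normrM (gtr0_norm (x := h^-1)) ?invr_gt0//.
  rewrite ler_pM2r ?invr_gt0//.
  have := coord_le_enorm (z - z') i; rewrite !mxE => /le_trans; apply.
  by rewrite (le_trans zs)// ler_norm.
have sm : `|s| / h + 1 < m%:R.
  rewrite -natr1 ltrD2r.
  by have /andP[] := truncn_itv (divr_ge0 (normr_ge0 s) (ltW h0)).
rewrite -/a -/b in a1 a2 b1 b2; rewrite !intrD in a2 b2.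
have abm : `|a - b| < m%:Z.
  rewrite -(ltr_int R) intr_norm intrB ltr_norml.
  have := ler_normlP _ _ zi => -[z1 z2].
  by apply/andP; split; rewrite /=; lra.
have ab : a = b.
  apply/eqP; rewrite -subr_eq0 -absz_eq0; apply/negPn/negP; rewrite -lt0n => ab0.
  have := dvdn_leq ab0 mab; rewrite absz_nat leqNgt => /negP; apply.
  by rewrite -ltz_nat abszE.
rewrite ab in a1 a2; rewrite !mxE -/h.
have -> : z 0 i - z' 0 i = (z 0 i / h - z' 0 i / h) * h.
  by rewrite mulrBl !divfK ?gt_eqF.
rewrite normrM (gtr0_norm h0) ger_pMl// ler_norml; lra.
Qed.

Definition spaced (r : R) (A : set point) : Prop :=
  forall z z', A z -> A z' -> enorm (z - z') < r -> z = z'.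

(** Distinct points of A get distinct colours of a suitable grid. *)
Lemma spaced_finite (r b : R) (A : set point) : 0 < r -> spaced r A ->
  (forall z, A z -> enorm z <= b) -> finite_set A.
Proof.
move=> r0 sA Ab; have [I [col colP]] := grid_colouring (b + b) r0.
apply: (@finite_set_inj _ _ _ [set: I] col) => //.
move=> z z'; rewrite !inE => Az Az' zz'; apply: sA => //; apply: colP => //.
by rewrite (le_trans (enormD _ _))// enormN lerD ?Ab.
Qed.

Definition dot x y : R := \sum_i x 0 i * y 0 i.

Lemma dotDl x y z : dot (x + y) z = dot x z + dot y z.
Proof. by rewrite /dot -big_split/=; apply: eq_bigr => i _; rewrite mxE mulrDl. Qed.

Lemma dotZl a x z : dot (a *: x) z = a * dot x z.
Proof. by rewrite /dot mulr_sumr; apply: eq_bigr => i _; rewrite mxE mulrA. Qed.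

Lemma dot_le x y : `|dot x y| <= enorm x * enorm y.
Proof.
rewrite -sqrtr_sqr /enorm -sqrtrM ?sumsq_ge0// ler_wsqrtr//.
exact: cauchy_schwarz_sum.
Qed.

Lemma enorm_sqrD x y : enorm (x + y) ^+ 2 = enorm x ^+ 2 + dot x y *+ 2 + enorm y ^+ 2.
Proof.
rewrite !sqr_sqrtr ?sumsq_ge0// -sumrMnl -!big_split/=; apply: eq_bigr => i _.
by rewrite mxE sqrrD.
Qed.

(** The function z |-> |z - q|^2 - |z - p|^2 is affine, nonnegative at y, and
    at least |p - q| (2 r - 2 |v|) on points at distance |v| from p; the
    strict inequality at a convex combination follows. Thus shrinking the closed
    cell of p by the factor l leaves a margin of (1 - l) r. *)
Lemma voronoi_inner (r l : R) y p q v : 0 <= l < 1 -> p <> q ->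
  2 * r <= enorm (p - q) -> enorm (y - p) <= enorm (y - q) ->
  enorm v < (1 - l) * r ->
  enorm (l *: (y - p) + v) < enorm (p + (l *: (y - p) + v) - q).
Proof.
move=> /andP[l0 l1] pq rpq ypq vr.
have N0 : 0 < enorm (p - q).
  by apply: enorm_gt0 => /eqP; rewrite subr_eq0 => /eqP.
rewrite -(ltr_pXn2r (n := 2))// ?nnegrE ?enorm_ge0//.
have -> : p + (l *: (y - p) + v) - q = (l *: (y - p) + v) + (p - q).
  by rewrite addrAC addrC.
rewrite (enorm_sqrD _ (p - q)) -addrA ltrDl dotDl dotZl.
move: ypq; rewrite -(ler_pXn2r (n := 2))// ?nnegrE ?enorm_ge0//.
have -> : y - q = (y - p) + (p - q) by rewrite addrA subrK.
rewrite (enorm_sqrD (y - p)) -addrA lerDl => h.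
have := dot_le v (p - q) => /ler_normlP[dv _].
move: N0 rpq h dv vr (enorm_ge0 v).
set N := enorm (p - q); set D := dot (y - p) _; set E := dot v _; set V := enorm v.
move=> N0 rN h dv vr V0.
rewrite -mulr_natl in h; rewrite -mulr_natl.
have : 2 * V * N < (1 - l) * N * N.
  rewrite ltr_pM2r//; apply: (@lt_le_trans _ _ ((1 - l) * (2 * r))); first by lra.
  by rewrite ler_pM2l//; lra.
have : l * (2 * D + N ^+ 2) >= 0 by rewrite mulr_ge0.
rewrite expr2; lra.
Qed.

(** The layers of the boundary. Here p is the centre of the cell S, the point
    set P is rho-dense, and f z k is a point of P within rho of the image of z
    under the homothety of centre p and ratio 1 - (k + 1) delta, where
    delta = 1 / (2 (K + 1)) keeps all ratios above 1/2. By [voronoi_inner] the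
    image has a margin of at least delta r, which absorbs both the distance c
    from z to the cell and the errors of size rho. If f z k = f z' k' with
    k < k', then z is, up to 4 rho, the image of z' under a homothety of ratio
    at most 1 - delta, hence z is in S. How ties between equidistant centres
    are broken does not matter: S is any set between the open and the closed
    cell. *)
Lemma voronoi_layers (P D S : set point) p (r rho c : R) (K : nat) :
  0 <= c -> 0 < rho ->
  (forall z, exists2 y, P y & enorm (y - z) < rho) ->
  (forall q, D q -> p <> q -> 2 * r <= enorm (p - q)) ->
  (forall y, S y -> forall q, D q -> enorm (y - p) <= enorm (y - q)) ->
  (forall y, P y -> (forall q, D q -> p <> q -> enorm (y - p) < enorm (y - q)) -> S y) ->
  (c + 4 * rho) * (2 * K.+1%:R) < r ->
  exists f : point -> nat -> point,
    let B := [set z | [/\ P z, ~ S z & exists2 y, S y & enorm (z - y) <= c]] in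
    (forall z k, B z -> (k < K)%N -> S (f z k)) /\
    (forall z z' k k', B z -> B z' -> (k < K)%N -> (k' < K)%N ->
       f z k = f z' k' -> k = k' /\ enorm (z - z') <= 4 * rho).
Proof.
move=> c0 rho0 cov Dp Snear Sin hr.
have /choice[g gP] : forall z, exists y, P y /\ enorm (y - z) < rho.
  by move=> z; have [y ? ?] := cov z; exists y.
(* delta, chosen so that K layers fit above the ratio 1/2. *)
pose de : R := (2 * K.+1%:R)^-1.
have K0 : 0 < K.+1%:R :> R by rewrite ltr0n.
have de0 : 0 < de by rewrite invr_gt0 mulr_gt0.
have deK : de * (2 * K.+1%:R) = 1 by rewrite mulVf// mulf_neq0// gt_eqF.
have hde : c + 4 * rho < de * r.
  by move: hr; rewrite -(ltr_pM2l de0) mulrCA deK mulr1.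
have r0 : 0 < r by rewrite (le_lt_trans _ hr)// mulr_ge0 ?mulr_ge0 ?addr_ge0//; lra.
pose l (k : nat) : R := 1 - k.+1%:R * de.
have lP k : (k < K)%N -> 2^-1 <= l k <= 1 - de.
  move=> kK; have : k.+1%:R <= K.+1%:R :> R by rewrite ler_nat ltnW.
  have : 1 <= k.+1%:R :> R by rewrite ler1n.
  rewrite /l => k1 kK'; have := ler_wpM2r (ltW de0) k1.
  by have := ler_wpM2r (ltW de0) kK'; lra.
have inside y (a : R) v z : S y -> 0 <= a <= 1 - de -> enorm v <= c + 4 * rho ->
    P z -> z = p + (a *: (y - p) + v) -> S z.
  move=> Sy /andP[a0 a1] vc Pz zE; apply: Sin => // q Dq pq.
  rewrite [z in X in X < _]zE [p + _]addrC addrK zE.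
  apply: (@voronoi_inner r); rewrite ?Dp ?Snear//; first by lra.
  rewrite (le_lt_trans vc)// (lt_le_trans hde)// ler_wpM2r// ?(ltW r0)//; lra.
exists (fun z k => g (p + l k *: (z - p))); split.
  move=> z k [Pz Sz [y Sy zy]] kK; have /andP[lk1 lk2] := lP k kK.
  have [Pg gd] := gP (p + l k *: (z - p)); move: Pg gd; set w := g _ => Pw wd.
  apply: (inside y (l k) (l k *: (z - y) + (w - (p + l k *: (z - p))))) => //.
  - by apply/andP; split; lra.
  - rewrite (le_trans (enormD _ _))// lerD//; last by rewrite (le_trans (ltW wd)) //; lra.
    rewrite enormZ ger0_norm; last by lra.
    by apply: le_trans zy; rewrite ler_piMl ?enorm_ge0//; lra.
  - by apply/rowP => i; rewrite !mxE; ring.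
(* Two images for which the same point of P is chosen are 2 rho apart, and all
   the ratios are at least 1/2. *)
have key z z' k k' : (k < K)%N -> (k' < K)%N ->
    g (p + l k *: (z - p)) = g (p + l k' *: (z' - p)) ->
    exists e, [/\ enorm e <= 4 * rho & z - p = (l k' / l k) *: (z' - p) + e].
  move=> kK kK' gg; have /andP[lk1 lk2] := lP k kK.
  have [_ g1] := gP (p + l k *: (z - p)); have [_ g2] := gP (p + l k' *: (z' - p)).
  rewrite -gg in g2; move: g1 g2; set w := g _ => g1 g2.
  exists ((l k)^-1 *: ((w - (p + l k' *: (z' - p))) - (w - (p + l k *: (z - p))))).
  have lk0 : 0 < l k by lra.
  split; last by apply/rowP => i; rewrite !mxE; field; rewrite gt_eqF.
  rewrite enormZ ger0_norm ?invr_ge0 ?(ltW lk0)// mulrC ler_pdivrMr//.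
  rewrite (le_trans (enormD _ _))// enormN (@le_trans _ _ (rho + rho))//.
    by rewrite lerD// ltW.
  have : rho * 2^-1 <= rho * l k by rewrite ler_pM2l.
  lra.
have mono z z' k k' : P z -> ~ S z -> (exists2 y, S y & enorm (z' - y) <= c) ->
    (k < k' < K)%N -> g (p + l k *: (z - p)) <> g (p + l k' *: (z' - p)).
  move=> Pz Sz [y Sy zy] /andP[kk' kK'] gg; have kK := ltn_trans kk' kK'.
  have [e [e4 zE]] := key _ _ _ _ kK kK' gg.
  have /andP[lk1 lk2] := lP k kK; have /andP[lk1' lk2'] := lP k' kK'.
  have lk0 : 0 < l k by lra.
  have a1 : l k' / l k <= 1 - de.
    rewrite ler_pdivrMr//.
    have : k.+2%:R * de <= k'.+1%:R * de by rewrite ler_pM2r// ler_nat.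
    rewrite -natr1 mulrDl mul1r => h.
    have : de * l k <= de * 1 by rewrite ler_pM2l//; lra.
    rewrite /l in h *; lra.
  have a0 : 0 <= l k' / l k by rewrite divr_ge0//; lra.
  apply/Sz/(inside y (l k' / l k) ((l k' / l k) *: (z' - y) + e)) => //.
  - by rewrite a0.
  - rewrite (le_trans (enormD _ _))// lerD// enormZ ger0_norm//.
    by apply: le_trans zy; rewrite ler_piMl ?enorm_ge0//; lra.
  - rewrite -[z](subrK p) zE addrC; congr (p + _).
    by apply/rowP => i; rewrite !mxE; ring.
move=> z z' k k' [Pz Sz zc] [Pz' Sz' zc'] kK kK' gg.
have kk' : k = k'.
  case: (ltngtP k k') => // h; exfalso.
    by apply: (mono z z' k k') gg; rewrite ?h.
  by apply: (mono z' z k' k) (esym gg); rewrite ?h.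
split=> //; rewrite -kk' in gg; have [e [e4]] := key _ _ _ _ kK kK gg.
have /andP[lk1 lk2] := lP k kK.
rewrite divff ?scale1r ?gt_eqF//; last by lra.
have -> : z - z' = (z - p) - (z' - p) by rewrite opprB addrA subrK.
by move=> ->; rewrite [_ + e]addrC addrK.
Qed.

End geometry.

(** * Tilings which agree on a ball *)

(** Take the maximum of the thresholds. *)
Lemma finite_uniform (T : Type) (A : set T) (Q : T -> nat -> Prop) :
  finite_set A -> (forall a, A a -> exists n, forall m, (n <= m)%N -> Q a m) ->
  exists n, forall a, A a -> Q a n.
Proof.
move=> fA AQ.
have /choice[N NP] : forall a, exists n, A a -> forall m, (n <= m)%N -> Q a m.
  by move=> a; have [/AQ[n ?]|?] := pselect (A a); [exists n|exists 0%N].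
have /finite_seqP[s sE] := finite_image N fA.
exists (\max_(i <- s) i)%N => a Aa; apply: NP => //.
have : N a \in s by have : (N @` A) (N a) by [exists a]; rewrite sE.
by move=> /(@leq_bigmax_seq _ s xpredT id); apply.
Qed.

Lemma mx_norm_le_enorm {R : realType} {d : nat} (z : 'rV[R]_d) : `|z| <= enorm z.
Proof.
rewrite [leLHS]/Num.norm /= mx_normrE; apply/bigmax_leP; split; first exact: enorm_ge0.
by move=> -[i j] _ /=; rewrite (ord1 i) coord_le_enorm.
Qed.

Lemma closed_unit_ball_compact {R : realType} {d : nat} :
  compact [set z : 'rV[R]_d | enorm z <= 1].
Proof.
apply: bounded_closed_compact.
  exists 1; split; first by rewrite num_real.
  move=> M M1 z /= z1; apply: le_trans (mx_norm_le_enorm z) _.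
  by rewrite (le_trans z1)// ltW.
rewrite -[X in closed X]setCK; apply: open_closedC; rewrite openE => z /= /negP.
rewrite -ltNge => z1; apply/interior_eball; exists (enorm z - 1).
  by rewrite subr_gt0.
move=> y; rewrite /eball/= enormB => zy; apply/negP; rewrite -ltNge.
have := enormD (z - y) y; rewrite subrK; lra.
Qed.

(** A tile is a continuous image of the compact unit ball. *)
Lemma homeo_closed_ball_bounded {R : realType} {d : nat} (A : set 'rV[R]_d) :
  homeo_closed_ball A -> exists M : R, forall z, A z -> enorm z <= M.
Proof.
move=> [f [g [_ cg fB _ [gf _]]]].
have [M [_ MB]] := compact_bounded (continuous_compact cg closed_unit_ball_compact).
exists ((`|M| + 1) * d.+1%:R + 1) => z Az.
have zM : `|z| <= `|M| + 1.
  apply: (MB (`|M| + 1)); first by rewrite (le_lt_trans (ler_norm _)) ?ltrDl.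
  by exists (f z); [apply: fB; exists z|rewrite gf].
apply: ltW; apply: enorm_lt_coords => [|i]; first by rewrite ltr_wpDl// mulr_ge0// addr_ge0.
rewrite ler_pdivlMr// (@le_trans _ _ ((`|M| + 1) * d.+1%:R)) ?lerDl//.
rewrite ler_pM2r// (le_trans _ zM)//.
rewrite [leRHS]/Num.norm /= mx_normrE; apply/bigmax_geP; right.
by exists (0, i).
Qed.

Section tilings.
Context {R : realType} {d : nat} {L : Type}.
Local Notation point := 'rV[R]_d.
Local Notation tile := (tile R d L).
Implicit Types (t : tile) (w : set tile) (y z v : point).

Definition agree (rho : R) w w' :=
  meeting w (eball 0 rho) = meeting w' (eball 0 rho).

Lemma agree_le (rho rho' : R) w w' : rho' <= rho -> agree rho w w' -> agree rho' w w'.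
Proof.
move=> h; apply: meeting_subset => z; rewrite /eball/= => /lt_le_trans; exact.
Qed.

Lemma agree_shift (rho rho' : R) w w' v : agree rho w w' -> rho' + enorm v <= rho ->
  agree rho' (translate w v) (translate w' v).
Proof.
move=> h le; rewrite /agree !meeting_shift; congr translate.
apply: meeting_subset h => z; rewrite /eball/= !subr0 => zv.
rewrite -[z](addrK v) (le_lt_trans (enormD _ _))// enormN (lt_le_trans _ le)//.
by rewrite ltrD2r.
Qed.

Lemma agreeP (rho : R) w w' t z : agree rho w w' -> w t -> t.1 z -> enorm z < rho -> w' t.
Proof.
move=> h wt tz zr; have : meeting w (eball 0 rho) t.
  by split=> //; exists z; split => //; rewrite /eball/= subr0.
by rewrite h => -[].
Qed.

Lemma eps_close_agree (rho : R) w w' : 1 < rho -> agree rho w w' -> tdist w w' <= rho^-1.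
Proof.
move=> r1 h; have r0 : 0 < rho by rewrite (lt_trans _ r1).
apply: tdist_le; split; first by rewrite invr_gt0 r0 invf_lt1.
exists 0, 0; rewrite enorm0 !translate0 invrK; split=> //;
  by rewrite invr_ge0 ltW.
Qed.

Variables (P : prototile_set R d L) (x : puncturing P).

Definition radii (r rho : R) : Prop := [/\ 0 < r, 0 < rho &
  forall p, protos P p -> eball (x p) r `<=` p.1 /\ p.1 `<=` eball (x p) rho].

(** There are finitely many prototiles, each bounded and with its puncture in
    the interior. *)
Lemma radii_exist : exists r rho, radii r rho.
Proof.
have h p : protos P p -> exists n : nat, forall m, (n <= m)%N ->
    eball (x p) m.+1%:R^-1 `<=` p.1 /\ p.1 `<=` eball (x p) m.+1%:R.
  move=> Pp; have /interior_eball[r r0 rp] := punct_int x Pp.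
  have [M Mp] : exists M : R, forall z, p.1 z -> enorm (z - x p) < M.
    have [M pM] := homeo_closed_ball_bounded (protos_ball Pp).
    exists (M + enorm (x p) + 1) => z /pM zM.
    by rewrite (le_lt_trans (enormD _ _))// enormN ltr_pwDr// lerD2r.
  have MM : `|M| < (Num.truncn `|M|).+1%:R by have /andP[] := truncn_itv (normr_ge0 M).
  have rr : r^-1 < (Num.truncn r^-1).+1%:R.
    have : 0 <= r^-1 by rewrite invr_ge0 ltW.
    by move=> /truncn_itv/andP[].
  exists (maxn (Num.truncn `|M|) (Num.truncn r^-1)) => m; rewrite geq_max => /andP[m1 m2].
  split=> [z|z pz].
    rewrite /eball/= => zm; apply: rp; apply: (lt_le_trans zm).
    rewrite -[leRHS]invrK lef_pV2 ?posrE ?invr_gt0// (le_trans (ltW rr))//.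
    by rewrite ler_nat.
  rewrite /eball/= (lt_le_trans (Mp _ pz))// (le_trans (ler_norm _))//.
  by rewrite (le_trans (ltW MM))// ler_nat.
have [n hn] := finite_uniform (protos_finite P) h.
by exists n.+1%:R^-1, n.+1%:R; split; rewrite ?invr_gt0.
Qed.

Definition punctures w : set point := [set z | exists2 t, w t & tile_punct x t = z].

Lemma puncturesD w v z : is_tiling P w -> punctures (translate w v) z <-> punctures w (z - v).
Proof.
move=> tw; split=> [[_ [t wt <-] <-]|[t wt tz]].
  by exists t => //; rewrite (tile_punct_shift _ _ tw wt) addrK.
exists (translate_tile t v); first by exists t.
by rewrite (tile_punct_shift _ _ tw wt) tz subrK.
Qed.

Context (r rho : R) (hr : radii r rho).

Let r0 : 0 < r. Proof. by case: hr. Qed.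
Let rho0 : 0 < rho. Proof. by case: hr. Qed.

Lemma tile_radii w t : is_tiling P w -> w t ->
  eball (tile_punct x t) r `<=` t.1 /\ t.1 `<=` eball (tile_punct x t) rho.
Proof.
have [_ _ h] := hr; move=> [tw _ _] /tw[p [y [Pp ->]]]; rewrite tile_punctE//.
have [h1 h2] := h p Pp; split=> z.
  rewrite /eball/= => zr; apply/translate_tileP/h1.
  by rewrite /eball/= -addrA -opprD [y + _]addrC.
by move=> /translate_tileP/h2; rewrite /eball/= -addrA -opprD [y + _]addrC.
Qed.

Lemma tile_punct_in w t : is_tiling P w -> w t -> t.1 (tile_punct x t).
Proof.
by move=> tw wt; apply: (tile_radii tw wt).1; rewrite /eball/= subrr enorm0.
Qed.

(** Otherwise the puncture of t' would be interior to both tiles. *)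
Lemma tile_punct_close w t t' : is_tiling P w -> w t -> w t' ->
  enorm (tile_punct x t - tile_punct x t') < r -> t = t'.
Proof.
move=> tw wt wt' tt'; apply: contrapT => ne.
have [_ _ dis] := tw; have := dis _ _ wt wt' ne; apply/eqP/set0P.
exists (tile_punct x t'); split; last exact: tile_punct_int tw wt'.
apply/interior_eball; exists (r - enorm (tile_punct x t - tile_punct x t')); first by rewrite subr_gt0.
move=> z; rewrite /eball/= => zr; apply: (tile_radii tw wt).1; rewrite /eball/=.
rewrite -[z](subrK (tile_punct x t')) -addrA (le_lt_trans (enormD _ _))//.
by rewrite (enormB _ (tile_punct x t)) -ltrBrDr.
Qed.

Lemma punctures_spaced w : is_tiling P w -> spaced r (punctures w).
Proof.
by move=> tw _ _ [t wt <-] [t' wt' <-] /(tile_punct_close tw wt wt')->.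
Qed.

Lemma punctures_cover w z : is_tiling P w ->
  exists2 y, punctures w y & enorm (y - z) < rho.
Proof.
move=> tw; have [_ cov _] := tw; have [t wt tz] : (\bigcup_(t in w) t.1) z by rewrite cov.
exists (tile_punct x t); first by exists t.
by rewrite enormB; apply: (tile_radii tw wt).2.
Qed.

Lemma agree_punctures (s : R) w w' z : is_tiling P w -> agree s w w' -> enorm z < s ->
  punctures w z -> punctures w' z.
Proof.
move=> tw h zs [t wt tz]; exists t => //.
by apply: (agreeP h wt (z := z)) => //; rewrite -tz; apply: tile_punct_in wt.
Qed.

Lemma punctures_finite (b : R) w : is_tiling P w ->
  finite_set [set z | punctures w z /\ enorm z <= b].
Proof.
move=> tw; apply: (@spaced_finite _ _ r b) => //; last by move=> z [].
by move=> z z' [wz _] [wz' _]; apply: (punctures_spaced tw).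
Qed.

Lemma meeting_finite (b : R) w z : is_tiling P w -> finite_set (meeting w (eball z b)).
Proof.
move=> tw; apply: (@finite_set_inj _ _ _ _ (tile_punct x)); last first.
- exact: (punctures_finite (enorm z + b + rho) tw).
- move=> _ [t [wt [y [ty yz]]] <-]; split; first by exists t.
  have := (tile_radii tw wt).2 _ ty; rewrite /eball/= in yz *; rewrite enormB => yt.
  have := enormD (tile_punct x t - y) y; have := enormD (y - z) z.
  by rewrite !subrK; lra.
- move=> t t'; rewrite !inE => -[wt _] [wt' _] tt'.
  by apply: (tile_punct_close tw wt wt'); rewrite tt' subrr enorm0.
Qed.

(** The two small vectors in the definition of closeness can only be equal: the tile of w punctured at 0 reappears in w' with its puncture
    moved by their difference, and 0 is the only puncture of w' that near 0. *)
Lemma tdist_agree (s : R) : exists2 e : R, 0 < e & forall w w',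
  is_tiling P w -> is_tiling P w' -> punctures w 0 -> punctures w' 0 ->
  tdist w w' < e -> agree s w w'.
Proof.
pose e := Num.min (r / 2) (`|s| + 2)^-1.
have s0 : 0 < `|s| + 2 by rewrite ltr_wpDl.
have e0 : 0 < e by rewrite lt_min divr_gt0// invr_gt0.
have er : e <= r / 2 by rewrite ge_min lexx.
have es : e <= (`|s| + 2)^-1 by rewrite ge_min lexx orbT.
have e1 : e <= 1 by rewrite (le_trans es)// invf_le1//; have := normr_ge0 s; lra.
exists e => // w w' tw tw' w0 w'0 /(tdist_lt e1)[c ce [/andP[c0 c1] [x1 [x2 [h1 h2 h]]]]].
have ic : `|s| + 2 <= c^-1.
  by rewrite -[leLHS]invrK lef_pV2 ?posrE ?invr_gt0// (le_trans (ltW ce)).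
have x12 : x1 = x2.
  have p1 : punctures (translate w x1) x1 by apply/(puncturesD _ _ tw); rewrite subrr.
  have : punctures (translate w' x2) x1.
    apply: agree_punctures h _ p1; first exact: is_tiling_shift.
    rewrite (le_lt_trans h1)// (lt_le_trans _ ic)//; have := normr_ge0 s; lra.
  move=> /(puncturesD _ _ tw') p2; apply/eqP; rewrite -subr_eq0; apply/eqP.
  apply: (punctures_spaced tw') => //.
  by rewrite subr0 (le_lt_trans (enormD _ _))// enormN; lra.
rewrite -(translateK w x1) -(translateK w' x1); apply: (agree_shift (rho := c^-1)).
  by rewrite /agree h x12.
by rewrite enormN (le_trans _ ic)// lerD ?ler_norm//; lra.
Qed.

End tilings.

(** * Compactness of the punctured hull *)

Lemma ultrafilter_finite (X : Type) (Y : choiceType) (F : set_system X)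
    (A : set Y) (f : X -> Y) :
  UltraFilter F -> finite_set A -> F (f @^-1` A) -> exists2 a, A a & F (f @^-1` [set a]).
Proof.
move=> UF /finite_fsetP[D ->] FA; apply: contrapT => h.
have : F (\bigcap_(a in [set` D]) ~` (f @^-1` [set a])).
  apply: filter_bigI => a aD; have [Fa|//] := in_ultra_setVsetC (f @^-1` [set a]) UF.
  by exfalso; apply: h; exists a.
by move=> /(filterI FA)/filter_ex[u [/= fu /(_ _ fu)]]; apply.
Qed.

Section hull.
Context {R : realType} {d : nat} {L : Type}.
Variables (P : prototile_set R d L) (x : puncturing P) (T : set (tile R d L)).
Context (r rho : R) (hr : radii x r rho).
Context (T_tiling : is_tiling P T) (T_FLC : FLC T).
Local Notation point := 'rV[R]_d.
Local Notation U := (punctured_hull x T).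
Implicit Types (u v : U) (y z : point).

Lemma punctures0 u : punctures x (ptiling u) 0.
Proof. by have [_ [t ut t0]] := ptilingP u; exists t. Qed.

Let ut u : is_tiling P (ptiling u) := ptiling_tiling u.

(** Tilings of the hull are limits of translates of T, and the small motions
    allowed by the metric can be absorbed in the translation. *)
Lemma hull_patch (s : R) u :
  exists2 z, punctures x T z & agree s (ptiling u) (translate T (- z)).
Proof.
wlog s0 : s / 0 < s.
  move=> h; have [|z Tz uz] := h (`|s| + 1); first by rewrite ltr_wpDl.
  exists z => //; apply: agree_le uz; rewrite (le_trans (ler_norm _))//.
  by rewrite lerDl.
have [[_ hu] _] := ptilingP u.
pose e := (s + 2)^-1; have e0 : 0 < e by rewrite invr_gt0 ltr_wpDl// ltW.
have e1 : e <= 1 by rewrite invf_le1; lra.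
have [y /(tdist_lt e1)[c ce [/andP[c0 c1] [x1 [x2 [h1 h2 h]]]]]] := hu e e0.
have ic : s + 2 <= c^-1.
  by rewrite -[leLHS]invrK lef_pV2 ?posrE// ltW.
have uz : agree s (ptiling u) (translate T (y + x2 - x1)).
  rewrite -(translateK (ptiling u) x1) -!translateD.
  apply: (agree_shift (rho := c^-1)); first exact: h.
  by rewrite enormN (le_trans _ ic)// lerD2l; lra.
exists (- (y + x2 - x1)); last by rewrite opprK.
have := agree_punctures hr (ut u) uz _ (punctures0 u).
by rewrite enorm0 => /(_ s0)/(puncturesD _ _ _ T_tiling); rewrite sub0r.
Qed.

(** Finite local complexity gives the patches of T up to translation only, but
    a patch of finitely many tiles has finitely many translates with a
    puncture at the origin. *)
Lemma patches_finite (s : R) : 0 < s ->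
  finite_set (range (fun u => meeting (ptiling u) (eball 0 s))).
Proof.
move=> s0; have [X fX XT] := T_FLC s0.
pose X' := X `&` [set Q | finite_set Q].
apply: (@sub_finite_set _ _ (\bigcup_(Q in X')
    ((fun q => translate Q (- tile_punct x q)) @` Q))); last first.
  apply: bigcup_finite; first exact: finite_setIl.
  by move=> Q [_ fQ]; apply: finite_image.
move=> _ [u _ <-]; have [z Tz uz] := hull_patch s u.
have [Q [y [XQ Qy]]] := XT z.
have uE : meeting (ptiling u) (eball 0 s) = translate Q (y - z).
  rewrite uz meeting_shift -translateD -Qy; congr (translate (meeting _ _) _).
  by apply/seteqP; split => w; rewrite /eball/= subr0.
exists Q.
  split=> //=; rewrite -(translateK Q y) -Qy.
  by apply: finite_image; apply: meeting_finite hr _ _ _ T_tiling.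
have [t wt t0] := punctures0 u.
have : meeting (ptiling u) (eball 0 s) t.
  split=> //; exists 0; split; last by rewrite /eball/= subr0 enorm0.
  by rewrite -t0; apply: (tile_punct_in hr) wt.
rewrite uE => -[q Qq qt]; exists q => //; congr translate.
have -> : q = translate_tile t (- (y - z)) by rewrite -qt translate_tileK.
by rewrite (tile_punct_shift _ _ (ut u) wt) t0 add0r opprK.
Qed.

Lemma locally_constant_finite (Y : Type) (f : U -> Y) (s : R) : 0 < s ->
  (forall u v, agree s (ptiling u) (ptiling v) -> f u = f v) -> finite_set (range f).
Proof.
move=> s0 fs; pose g u := meeting (ptiling u) (eball 0 s).
apply: (@sub_finite_set _ _ (\bigcup_(Q in range g) (f @` [set u | g u = Q]))).
  by move=> _ [u _ <-]; exists (g u) => //; exists u.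
apply: bigcup_finite; first exact: patches_finite.
move=> _ [u _ <-]; apply: (@sub_finite_set _ _ [set f u]) => //.
by move=> _ [v /= vu <-]; apply: fs.
Qed.

(** By [eps_close_agree] and [tdist_agree], the sets of tilings which agree with
    u on a ball are cofinal with the balls of the tiling metric about u. *)
Lemma nbhs_hullP u (A : set U) :
  nbhs u A <-> exists s : R, forall v, agree s (ptiling u) (ptiling v) -> A v.
Proof.
split.
  move=> /nbhs_ballP[e /= e0 eA]; pose s := Num.max 2 (e / 2)^-1.
  have s2 : 2 <= s by rewrite le_max lexx.
  exists s => v /eps_close_agree h; apply: eA; rewrite ballEmdist/=.
  apply: le_lt_trans (h _) _; first lra.
  apply: (@le_lt_trans _ _ (e / 2)); last by lra.
  by rewrite -[leRHS]invrK lef_pV2 ?posrE ?invr_gt0 ?divr_gt0//; [rewrite le_max lexx orbT|lra].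
move=> [s sA]; have [e e0 eP] := tdist_agree hr s.
apply/nbhs_ballP; exists e => //= v; rewrite ballEmdist => /= uv; apply: sA.
exact: (eP _ _ (ut u) (ut v) (punctures0 u) (punctures0 v) uv).
Qed.

(** Given an ultrafilter, the tiles which belong to almost all tilings form the
    limit. On every ball it agrees with almost all tilings, because only
    finitely many patches are possible there, and being a punctured tiling in
    the closure of the orbit of T can be tested on balls. *)
Lemma hull_compact : compact [set: U].
Proof.
rewrite compact_ultra => F UF _.
have patch (s : R) : 0 < s -> exists c : U, F [set u : U | agree s (ptiling u) (ptiling c)].
  move=> s0; pose g u := meeting (ptiling u) (eball 0 s).
  have [|_ [c _ <-] Fc] := @ultrafilter_finite _ _ F _ g UF (patches_finite s0).
    by apply: filterS filterT => u _; exists u.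
  by exists c; apply: filterS Fc => u.
pose w := [set t | F [set u : U | ptiling u t]].
have wagree s (c : U) : F [set u : U | agree s (ptiling u) (ptiling c)] -> agree s w (ptiling c).
  move=> Fc; apply/seteqP; split => t [wt [z [tz zs]]].
    have [u [/= ut1 uc]] := filter_ex (filterI wt Fc).
    split; last by exists z.
    by apply: agreeP uc ut1 tz _; move: zs; rewrite /eball/= subr0.
  split; last by exists z.
  apply: filterS Fc => u /= /esym uc.
  by apply: agreeP uc wt tz _; move: zs; rewrite /eball/= subr0.
have wpatch s : 0 < s -> exists c : U, agree s w (ptiling c).
  by move=> /patch[c Fc]; exists c; exact: wagree.
have wt : is_tiling P w.
  split.
  - by move=> t /filter_ex[u /= uut]; have [h _ _] := ut u; apply: h uut.
  - apply/seteqP; split => // z _; have [|c wc] := wpatch (enorm z + 1).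
      by rewrite ltr_wpDl ?enorm_ge0.
    have [_ cov _] := ut c.
    have [t ct tz] : (\bigcup_(t in ptiling c) t.1) z by rewrite cov.
    by exists t => //; apply: (agreeP (esym wc) ct tz); rewrite ltrDl.
  - move=> t t' wt wt'; have [u [/= h h']] := filter_ex (filterI wt wt').
    by have [_ _ dis] := ut u; apply: dis.
have w0 : punctures x w 0.
  have [c wc] := wpatch 1 ltr01.
  by apply: (agree_punctures hr (ut c) (esym wc) _ (punctures0 c)); rewrite enorm0.
have hw : hull P T w.
  split=> // e e0; pose s := Num.max 2 (e / 2)^-1.
  have s2 : 2 <= s by rewrite le_max lexx.
  have [|c wc] := wpatch s; first by lra.
  have [z _ cz] := hull_patch s c; exists (- z).
  apply: le_lt_trans (eps_close_agree _ (etrans wc cz)) _; first by lra.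
  apply: (@le_lt_trans _ _ (e / 2)); last by lra.
  by rewrite -[leRHS]invrK lef_pV2 ?posrE ?invr_gt0 ?divr_gt0//; [rewrite le_max lexx orbT|lra].
exists (PuncturedHull (conj hw w0)); split=> // A /nbhs_hullP[s sA].
have [|c Fc] := patch (Num.max s 1); first by rewrite lt_max ltr01 orbT.
apply: (filterS _ Fc) => u uc; apply: sA.
apply: (@agree_le _ _ _ (Num.max s 1)); first by rewrite le_max lexx.
by apply: etrans (wagree _ _ Fc) (esym uc).
Qed.

End hull.

(** * Centres of the Voronoi cells *)

Lemma finite_argmin {R : realType} (Y : eqType) (A : set Y) (f : Y -> R) :
  finite_set A -> A !=set0 -> exists2 a, A a & forall a', A a' -> f a <= f a'.
Proof.
move=> /finite_seqP[s ->]; elim: s => [[]//|a s IH _].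
have [/IH[a1 /= a1s a1P]|s0] := pselect ([set` s] !=set0); last first.
  exists a => /=; first by rewrite mem_head.
  by move=> a'; rewrite inE => /predU1P[->//|a's]; exfalso; apply: s0; exists a'.
have [aa|aa] := leP (f a) (f a1).
  exists a => /=; first by rewrite mem_head.
  move=> a'; rewrite inE => /predU1P[->//|/a1P]; exact: le_trans.
exists a1 => /=; first by rewrite inE a1s orbT.
by move=> a'; rewrite inE => /predU1P[->|/a1P//]; exact: ltW.
Qed.

Section markers.
Context {R : realType} {d : nat} {L : Type}.
Variables (P : prototile_set R d L) (x : puncturing P).
Context (r rho : R) (hr : radii x r rho).
Local Notation point := 'rV[R]_d.
Implicit Types (w : set (tile R d L)) (y z : point) (Qs : seq (set (tile R d L))).

Definition local_patch (s : R) w z := meeting (translate w (- z)) (eball 0 s).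

(** The greedy selection. The list Qs enumerates patches; the punctures which
    see the head of the list are added last. *)
Fixpoint markers (b s : R) Qs w : set point :=
  if Qs is Q :: Qs' then
    markers b s Qs' w `|` [set z | [/\ punctures x w z, local_patch s w z = Q &
      forall z', markers b s Qs' w z' -> b <= enorm (z' - z)]]
  else set0.

Lemma markers_punctures b s Qs w : markers b s Qs w `<=` punctures x w.
Proof. by elim: Qs => [|Q Qs IH] z //= [/IH|[]]. Qed.

(** Two points selected at the same stage see the same patch. *)
Lemma markers_spaced b s Qs w :
  (forall z z', punctures x w z -> punctures x w z' -> enorm (z' - z) < b ->
     local_patch s w z = local_patch s w z' -> z = z') ->
  spaced b (markers b s Qs w).
Proof.
move=> h; elim: Qs => [|Q Qs IH] z z' //= [mz|[pz zQ far]] [mz'|[pz' z'Q far']].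
- exact: IH.
- by rewrite ltNge far'.
- by rewrite enormB ltNge far.
- by move=> zz'; apply: h => //; rewrite ?zQ// enormB.
Qed.

(** A puncture rejected at the stage of its own patch is near a point selected
    before. *)
Lemma markers_cover b s Qs w z : 0 < b -> punctures x w z -> local_patch s w z \in Qs ->
  exists2 z', markers b s Qs w z' & enorm (z' - z) < b.
Proof.
move=> b0 pz; elim: Qs => [|Q Qs IH]; first by rewrite in_nil.
rewrite inE => /predU1P[zQ|/IH[z' mz' zz']]; last by exists z' => //; left.
have [[z' mz' zz']|h] := pselect (exists2 z', markers b s Qs w z' & enorm (z' - z) < b).
  by exists z' => //; left.
exists z; last by rewrite subrr enorm0.
right; split=> // z' mz'; rewrite leNgt; apply/negP => zz'; apply: h.
by exists z'.
Qed.

(** Each stage looks one step of length b further. Comparing two tilings at two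
    base points gives at the same time that the selection is locally determined
    (z = z') and that it commutes with translations (w' a translate of w). *)
Lemma markers_local b s Qs w w' z z' : 0 < s -> 0 <= b ->
  is_tiling P w -> is_tiling P w' ->
  agree (s + b *+ size Qs) (translate w (- z)) (translate w' (- z')) ->
  markers b s Qs w z -> markers b s Qs w' z'.
Proof.
move=> s0 b0; elim: Qs w w' z z' => [//|Q Qs IH] w w' z z' tw tw' /= ww'.
have sb : s <= s + b *+ (size Qs).+1 by rewrite lerDl mulrn_wge0.
case=> [mz|[pz zQ far]].
  left; apply: IH mz => //; apply: agree_le ww'.
  by rewrite lerD2l mulrS lerDr.
right; split.
- have : punctures x (translate w (- z)) 0 by apply/(puncturesD _ _ _ tw); rewrite sub0r opprK.
  move=> /(agree_punctures hr (is_tiling_shift _ tw) ww'); rewrite enorm0.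
  by move=> /(_ (lt_le_trans s0 sb))/(puncturesD _ _ _ tw'); rewrite sub0r opprK.
- by rewrite -zQ; apply/esym; apply: agree_le ww'.
- move=> z1' mz1'; rewrite leNgt; apply/negP => near.
  have mz1 : markers b s Qs w (z + (z1' - z')).
    apply: IH mz1' => //.
    have -> : - z1' = - z' - (z1' - z') by rewrite opprB addrA addNr sub0r.
    rewrite (opprD z) -!translateD; apply: agree_shift (esym ww') _.
    by rewrite enormN -addrA lerD2l mulrSr lerD2l ltW.
  by have := far _ mz1; rewrite [z + _]addrC addrK leNgt near.
Qed.

End markers.

(** Freeness of the action of translations on the hull of T. *)
Definition nonperiodic_hull {R : realType} {d : nat} {L : Type}
    (P : prototile_set R d L) T : Prop :=
  forall T', hull P T T' -> forall v, translate T' v = T' -> v = 0.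

Section centres.
Context {R : realType} {d : nat} {L : Type}.
Variables (P : prototile_set R d L) (x : puncturing P) (T : set (tile R d L)).
Context (r rho : R) (hr : radii x r rho).
Context (T_tiling : is_tiling P T) (T_FLC : FLC T) (T_aperiodic : nonperiodic_hull P T).
Local Notation point := 'rV[R]_d.
Local Notation U := (punctured_hull x T).
Implicit Types (u v : U) (y z : point).

Lemma hull_shift_punctured u y : punctures x (ptiling u) y ->
  exists v : U, ptiling v = translate (ptiling u) (- y).
Proof.
move=> uy; have [hu _] := ptilingP u.
suff h : hull P T (translate (ptiling u) (- y)) /\
    exists2 t, translate (ptiling u) (- y) t & tile_punct x t = 0.
  by exists (PuncturedHull h).
split; first exact: hull_shift.
by apply/(puncturesD _ _ _ (ptiling_tiling u)); rewrite sub0r opprK.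
Qed.

Lemma agree_eq w w' : is_tiling P w -> is_tiling P w' ->
  (forall n : nat, exists2 m, (n <= m)%N & agree m%:R w w') -> w = w'.
Proof.
suff sub (v v' : set (tile R d L)) : is_tiling P v ->
    (forall n : nat, exists2 m, (n <= m)%N & agree m%:R v v') -> v `<=` v'.
  move=> tw tw' h; apply/seteqP; split; apply: sub => // n.
  by have [m nm hm] := h n; exists m.
move=> tv h t vt; have [m nm hm] := h (Num.truncn (enorm (tile_punct x t))).+1.
apply: (agreeP hm vt (z := tile_punct x t)); first exact: (tile_punct_in hr) vt.
have /truncn_itv/andP[_] := enorm_ge0 (tile_punct x t).
by move=> /lt_le_trans; apply; rewrite ler_nat.
Qed.

(** If u has no period, then each of the finitely many short translates
    of u differs from u on some ball, and a ball large enough for all of them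
    serves for every tiling near u; compactness makes the radius uniform. *)
Lemma no_short_return (b : R) : 0 < b -> exists2 s : R, 0 < s &
  forall u y, punctures x (ptiling u) y -> enorm y < b ->
    agree s (ptiling u) (translate (ptiling u) (- y)) -> y = 0.
Proof.
move=> b0; pose Q (n : nat) u := forall y, punctures x (ptiling u) y -> enorm y < b ->
  agree n%:R (ptiling u) (translate (ptiling u) (- y)) -> y = 0.
suff : \forall n \near \oo, [set: U] `<=` Q n.
  move=> [n _ nQ]; exists n.+1%:R; first by rewrite ltr0n.
  by move=> u; apply: (nQ n.+1) => //=.
have /compact_near_coveringP := hull_compact hr T_tiling T_FLC.
apply => u _; have tu := ptiling_tiling u.
have := @finite_uniform _ [set z | punctures x (ptiling u) z /\ enorm z <= b]
  (fun y n => y <> 0 -> ~ agree n%:R (ptiling u) (translate (ptiling u) (- y))).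
case=> [||n nP].
- exact: (punctures_finite hr b tu).
- move=> y [uy yb]; apply: contrapT => h.
  have y0 : y <> 0 by move=> y0; apply: h; exists 0%N.
  apply/y0/eqP; rewrite -oppr_eq0; apply/eqP.
  apply: (T_aperiodic (ptilingP u).1); apply/esym; apply: agree_eq => //.
    exact: is_tiling_shift.
  move=> n; apply: contrapT => hn; apply: h; exists n => m nm _ hm.
  by apply: hn; exists m.
exists ([set v : U | agree (n%:R + b) (ptiling u) (ptiling v)], [set m | (n <= m)%N]).
  split=> /=; last by exists n.
  by apply/(nbhs_hullP hr); exists (n%:R + b).
move=> [v m] [/= uv nm] y vy yb vvy.
have nb : n%:R <= n%:R + b :> R by rewrite lerDl ltW.
have uy : punctures x (ptiling u) y.
  apply: (agree_punctures hr (ptiling_tiling v) (esym uv)) => //.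
  by rewrite (lt_le_trans yb)// lerDr.
apply: contrapT => y0; apply: (nP y _ y0); first by split=> //; exact: ltW.
apply: (etrans (agree_le nb uv)).
apply: etrans (agree_le _ vvy) _; first by rewrite ler_nat.
apply: agree_shift (esym uv) _; by rewrite enormN lerD2l ltW.
Qed.

(** The centre c u of the cell of the origin is any nearest point of D u. It is
    chosen as a function of the set of nearest points alone; this set is locally
    determined and commutes with translations, hence so does the choice among
    equidistant points. *)
Lemma centres (b : R) : 0 < b -> exists (D : U -> set point) (c : U -> point) (s : R),
  [/\ 0 < s,
      forall u, spaced b (D u),
      forall u v y, ptiling v = translate (ptiling u) (- y) -> forall z, D v z <-> D u (z + y),
      forall u, [/\ D u (c u), enorm (c u) < b & forall z, D u z -> enorm (c u) <= enorm z] &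
      forall u v, agree s (ptiling u) (ptiling v) -> c u = c v].
Proof.
move=> b0; have [s s0 sP] := no_short_return b0.
have /finite_seqP[Qs QsE] := patches_finite hr T_tiling T_FLC s0.
pose D u := markers x b s Qs (ptiling u).
pose N u := [set v | D u v /\ forall z, D u z -> enorm v <= enorm z].
have patchQs u z : punctures x (ptiling u) z -> local_patch s (ptiling u) z \in Qs.
  move=> /hull_shift_punctured[v vE].
  have : range (fun u : U => meeting (ptiling u) (eball 0 s)) (local_patch s (ptiling u) z).
    by exists v => //; rewrite vE.
  by rewrite QsE.
have Dnear u : exists2 z, D u z & enorm z < b.
  have u0 := punctures0 u; have [z Dz zb] := markers_cover b0 u0 (patchQs u 0 u0).
  by exists z => //; rewrite subr0 in zb.
have Nex u : N u !=set0.
  have [z0 Dz0 z0b] := Dnear u.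
  have [||z [Dz zb] zmin] := @finite_argmin R _ [set z | D u z /\ enorm z <= b] enorm.
  - apply: sub_finite_set (punctures_finite hr b (ptiling_tiling u)).
    by move=> z [/markers_punctures].
  - by exists z0; split => //; exact: ltW.
  exists z; split=> // z' Dz'; have [zb'|zb'] := leP (enorm z') b; first exact: zmin.
  by rewrite (le_trans zb)// ltW.
pose S := s + b *+ size Qs + b.
have Dloc u v z : agree S (ptiling u) (ptiling v) -> enorm z <= b -> D u z -> D v z.
  move=> uv zb; apply: (markers_local hr) => //; first exact: ltW.
  - exact: ptiling_tiling.
  - exact: ptiling_tiling.
  - by apply: agree_shift uv _; rewrite enormN lerD2l.
exists D, (fun u => xget 0 (N u)), S; split.
- by rewrite ltr_wpDr ?ltW// ltr_wpDr// mulrn_wge0// ltW.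
- move=> u; apply: markers_spaced => z z' uz uz' zz' pzz'.
  have [v vE] := hull_shift_punctured uz.
  apply/eqP; rewrite eq_sym -subr_eq0; apply/eqP; apply: (sP v) => //.
    by rewrite vE; apply/(puncturesD _ _ _ (ptiling_tiling u)); rewrite opprK subrK.
  by rewrite vE translateD opprB addrA addNr add0r.
- move=> u v y vE z.
  have E : translate (ptiling v) (- z) = translate (ptiling u) (- (z + y)).
    by rewrite vE translateD -opprD addrC.
  by split; apply: (markers_local hr s0 (ltW b0) (ptiling_tiling _) (ptiling_tiling _));
    rewrite /agree E.
- move=> u; have [Du umin] : N u (xget 0 (N u)) by have [z Nz] := Nex u; apply: xgetPex; exists z.
  split=> //; have [z Dz zb] := Dnear u; exact: le_lt_trans (umin _ Dz) zb.
- suff h u v : agree S (ptiling u) (ptiling v) -> N u `<=` N v.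
    by move=> u v uv; congr xget; apply/seteqP; split; apply: h.
  move=> uv z [Dz zmin]; have [z0 Dz0 z0b] := Dnear u.
  have zb : enorm z < b by exact: le_lt_trans (zmin _ Dz0) z0b.
  split; first by apply: Dloc uv _ Dz; exact: ltW.
  move=> z' Dz'; have [z'b|z'b] := leP (enorm z') b; last by rewrite ltW// (lt_trans zb).
  by apply: zmin; apply: Dloc (esym uv) _ Dz'.
Qed.

End centres.

(** * Topology of the tiling groupoid *)

Section arrows.
Context {R : realType} {d : nat} {L : Type}.
Variables (P : prototile_set R d L) (x : puncturing P) (T : set (tile R d L)).
Context (r rho : R) (hr : radii x r rho).
Context (T_tiling : is_tiling P T) (T_FLC : FLC T) (T_free : nonperiodic_hull P T).
Local Notation point := 'rV[R]_d.
Local Notation U := (punctured_hull x T).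
Local Notation G := (rpunc x T).
Implicit Types (u v : U) (a b : G) (y z : point).

(** Two displacements between the same tilings differ by a period. *)
Lemma displaced_uniq u v y z : displaced u v y -> displaced u v z -> y = z.
Proof.
move=> [_ [_ _ vy]] [_ [_ _ vz]]; apply/eqP; rewrite -subr_eq0; apply/eqP.
apply: (T_free (ptilingP u).1); rewrite addrC -translateD -vz vy translateD.
by rewrite addNr translate0.
Qed.

Lemma displacementE a y : displaced (rpunc_rng a) (rpunc_src a) y -> displacement a = y.
Proof. exact/displaced_uniq/displacementP. Qed.

Lemma ptiling_src a :
  ptiling (rpunc_src a) = translate (ptiling (rpunc_rng a)) (- displacement a).
Proof. by have [t []] := displacementP a. Qed.

Lemma ptiling_rng a :
  ptiling (rpunc_rng a) = translate (ptiling (rpunc_src a)) (displacement a).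
Proof. by rewrite ptiling_src translateD addNr translate0. Qed.

Lemma punctures_displacement a : punctures x (ptiling (rpunc_rng a)) (displacement a).
Proof. by have [t [ut -> _]] := displacementP a; exists t. Qed.

Lemma arrow_exists u v y : punctures x (ptiling u) y ->
  ptiling v = translate (ptiling u) (- y) ->
  exists a, [/\ rpunc_rng a = u, rpunc_src a = v & displacement a = y].
Proof.
move=> [t ut ty] vE; have uv : displaced u v y by exists t.
by exists (RPunc (ex_intro _ y uv)); split=> //; apply: displacementE.
Qed.

Lemma arrow_from u y : punctures x (ptiling u) y ->
  exists a, rpunc_rng a = u /\ displacement a = y.
Proof.
move=> uy; have [v vE] := hull_shift_punctured uy.
by have [a [? _ ?]] := arrow_exists uy vE; exists a.
Qed.

Lemma arrow_eq_rng a b : rpunc_rng a = rpunc_rng b -> displacement a = displacement b -> a = b.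
Proof.
by move=> ab dab; apply: rpunc_eq => //; apply: ptiling_inj; rewrite !ptiling_src ab dab.
Qed.

Lemma arrow_eq_src a b : rpunc_src a = rpunc_src b -> displacement a = displacement b -> a = b.
Proof.
by move=> ab dab; apply: rpunc_eq => //; apply: ptiling_inj; rewrite !ptiling_rng ab dab.
Qed.

Lemma displacement_idt u : displacement (rpunc_idt u) = 0.
Proof. by apply: displacementE; exact: displaced0. Qed.

Lemma displacement_inv a : displacement (rpunc_inv a) = - displacement a.
Proof. by apply: displacementE; apply/displacedN/displacementP. Qed.

Lemma displacement_mul a b : rpunc_src a = rpunc_rng b ->
  displacement (rpunc_mul a b) = displacement a + displacement b.
Proof.
move=> ab; apply: displacementE; have [-> ->] := rpunc_mulP ab.
by apply: displacedD (displacementP a) _; rewrite ab; exact: displacementP.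
Qed.

Definition near_arrow (s : R) a : set G :=
  [set b | agree s (ptiling (rpunc_rng a)) (ptiling (rpunc_rng b)) /\
           displacement b = displacement a].

(** Displacements of nearby arrows coincide, since they are punctures of one
    tiling at distance less than r. *)
Lemma nbhs_arrowP a (A : set G) : nbhs a A <-> exists s : R, near_arrow s a `<=` A.
Proof.
split.
  move=> /nbhs_ballP[e /= e0 eA].
  have : nbhs (rpunc_rng a) (ball (rpunc_rng a) e) by exact: nbhsx_ballx.
  move=> /(nbhs_hullP hr)[s sP]; exists s => b [/sP + ab].
  rewrite ballEmdist/= => h; apply: eA; rewrite ballEmdist/=.
  by rewrite /mdist/= /rpunc_dist ab subrr enorm0 addr0.
move=> [s sA]; pose s' := Num.max s (enorm (displacement a) + 1).
have : nbhs (rpunc_rng a) [set v | agree s' (ptiling (rpunc_rng a)) (ptiling v)].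
  by apply/(nbhs_hullP hr); exists s'.
move=> /nbhs_ballP[e /= e0 eP]; have [r0 _ _] := hr.
apply/nbhs_ballP; exists (Num.min e r) => /=; first by rewrite lt_min e0.
move=> b; rewrite ballEmdist /= /mdist/= /rpunc_dist lt_min => /andP[abe abr].
have h0 := tdist_ge0 (ptiling (rpunc_rng a)) (ptiling (rpunc_rng b)).
have n0 := enorm_ge0 (displacement a - displacement b).
have ab : agree s' (ptiling (rpunc_rng a)) (ptiling (rpunc_rng b)).
  apply: eP; rewrite ballEmdist/=; apply: le_lt_trans abe; by rewrite /mdist/= lerDl.
apply: sA; split; first by apply: agree_le ab; rewrite le_max lexx.
apply/esym/(punctures_spaced hr (ptiling_tiling (rpunc_rng b))).
- apply: (agree_punctures hr (ptiling_tiling _) ab); last exact: punctures_displacement.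
  by rewrite lt_max ltrDl ltr01 orbT.
- exact: punctures_displacement.
- by apply: le_lt_trans abr; rewrite lerDr.
Qed.

Definition locally_determined (A : set G) : Prop :=
  forall a, exists s : R, forall b, near_arrow s a b -> (A a <-> A b).

Lemma locally_determined_clopen A : locally_determined A -> open A /\ closed A.
Proof.
have sub B : locally_determined B -> open B.
  move=> h; rewrite openE => a Ba; apply/nbhs_arrowP; have [s sP] := h a.
  by exists s => b /sP[+ _]; exact.
move=> h; split; first exact: sub.
rewrite -[A]setCK; apply: open_closedC; apply: sub => a; have [s sP] := h a.
by exists s => b /sP ab; rewrite /setC/= ab.
Qed.

Lemma locally_determined_displacement (Q : set point) :
  locally_determined [set a | Q (displacement a)].
Proof. by move=> a; exists 0 => b [_ ab] /=; rewrite ab. Qed.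

Lemma rpunc_rng_continuous : continuous (@rpunc_rng R d L P x T).
Proof.
move=> a A /= /(nbhs_hullP hr)[s sA]; apply/nbhs_arrowP.
by exists s => b [ab _]; exact: sA.
Qed.

Lemma near_arrow_inv s a b : near_arrow (s + enorm (displacement a)) a b ->
  near_arrow s (rpunc_inv a) (rpunc_inv b).
Proof.
move=> [ab dab]; split; last by rewrite !displacement_inv dab.
by rewrite /= !ptiling_src dab; apply: agree_shift ab _; rewrite enormN.
Qed.

Lemma rpunc_inv_continuous : continuous (@rpunc_inv R d L P x T).
Proof.
move=> a A /= /nbhs_arrowP[s sA]; apply/nbhs_arrowP.
by exists (s + enorm (displacement a)) => b /near_arrow_inv; exact: sA.
Qed.

Lemma rpunc_src_continuous : continuous (@rpunc_src R d L P x T).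
Proof.
move=> a; exact: (@continuous_comp _ _ _ (@rpunc_inv R d L P x T)
  (@rpunc_rng R d L P x T) a (@rpunc_inv_continuous a) (@rpunc_rng_continuous (rpunc_inv a))).
Qed.

Lemma rpunc_mul_continuous : {within [set ab : G * G | rpunc_src ab.1 = rpunc_rng ab.2],
  continuous (fun ab => rpunc_mul ab.1 ab.2)}.
Proof.
apply/subspace_continuousP => -[a b] /= ab A /nbhs_arrowP[s sA].
exists (near_arrow s a, near_arrow s b) => /=.
  by split; apply/nbhs_arrowP; exists s.
move=> [a' b'] [/= [aa daa] [_ dbb]] ab'; apply: sA; split.
  by have [-> _] := rpunc_mulP ab; have [-> _] := rpunc_mulP ab'.
by rewrite !displacement_mul// daa dbb.
Qed.

(** Bounded displacements take finitely many values, by finite local complexity;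
    along an ultrafilter the displacement is therefore constant and the range
    converges in the compact hull. *)
Lemma bounded_arrows_compact (b : R) : compact [set a : G | enorm (displacement a) <= b].
Proof.
set B := [set a | _]; rewrite compact_ultra => F UF FB.
pose f u := [set y | punctures x (ptiling u) y /\ enorm y <= b].
have fB : finite_set (@displacement R d L P x T @` B).
  apply: (@sub_finite_set _ _ (\bigcup_(Y in range f) Y)).
    move=> _ [a Ba <-]; exists (f (rpunc_rng a)); first by exists (rpunc_rng a).
    by split=> //; exact: punctures_displacement.
  apply: bigcup_finite; last first.
    by move=> _ [u _ <-]; exact: (punctures_finite hr b (ptiling_tiling u)).
  apply: (locally_constant_finite hr T_tiling T_FLC (s := `|b| + 1)).
    by rewrite ltr_wpDl.
  have sub u v y : agree (`|b| + 1) (ptiling u) (ptiling v) -> f u y -> f v y.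
    move=> uv [uy yb]; split=> //; apply: (agree_punctures hr (ptiling_tiling u) uv) => //.
    by rewrite (le_lt_trans yb)// (le_lt_trans (ler_norm b))// ltrDl.
  by move=> u v uv; apply/seteqP; split => y; apply: sub.
have [|y [a0 Ba0 a0y] Fy] := @ultrafilter_finite _ _ F _ (@displacement R d L P x T) UF fB.
  by apply: filterS FB => a Ba; exists a.
have [u [_ uF]] : [set: U] `&` cluster (@rpunc_rng R d L P x T @ F) !=set0.
  apply: (hull_compact hr T_tiling T_FLC); exact: filterT.
have Fu (s : R) : F [set a | agree s (ptiling u) (ptiling (rpunc_rng a))].
  pose A := [set v : U | agree s (ptiling u) (ptiling v)].
  have nA : nbhs u A by apply/(nbhs_hullP hr); exists s.
  have [//|FA] := in_ultra_setVsetC (@rpunc_rng R d L P x T @^-1` A) UF.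
  by have [v [/= ]] := uF (~` A) A FA nA.
have uy : punctures x (ptiling u) y.
  have [a [/= ua ay]] := filter_ex (filterI (Fu (enorm y + 1)) Fy).
  apply: (agree_punctures hr (ptiling_tiling (rpunc_rng a)) (esym ua)).
    by rewrite ltrDl.
  by rewrite -ay; exact: punctures_displacement.
have [a [au ay]] := arrow_from uy; exists a; split.
  by rewrite /B/= ay -a0y.
move=> A /nbhs_arrowP[s sA]; apply: filterS (filterI (Fu s) Fy) => a' [/= ua' a'y].
by apply: sA; split; rewrite ?au ?ay.
Qed.

(** The displacement is locally constant. *)
Lemma compact_displacement_bounded (C : set G) : compact C ->
  exists2 b : R, 0 <= b & forall a, C a -> enorm (displacement a) <= b.
Proof.
move=> /compact_near_coveringP/(_ nat \oo (fun n a => enorm (displacement a) <= n%:R)).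
case=> [|n _ nC].
- move=> a _; pose n := (Num.truncn (enorm (displacement a))).+1.
  exists (near_arrow 0 a, [set m | (n <= m)%N]).
    by split=> /=; [apply/nbhs_arrowP; exists 0|exists n].
  move=> [b m] [/= [_ ab] nm]; rewrite ab.
  have /truncn_itv/andP[_ /ltW] := enorm_ge0 (displacement a).
  by move=> /le_trans; apply; rewrite ler_nat.
- by exists n%:R => // a Ca; apply: (nC n) => //=.
Qed.

End arrows.

(** * The subgroupoid of pairs in one cell *)

Section cells.
Context {R : realType} {d : nat} {L : Type}.
Variables (P : prototile_set R d L) (x : puncturing P) (T : set (tile R d L)).
Context (r rho : R) (hr : radii x r rho).
Context (T_tiling : is_tiling P T) (T_FLC : FLC T) (T_free : nonperiodic_hull P T).
Local Notation point := 'rV[R]_d.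
Local Notation U := (punctured_hull x T).
Local Notation G := (rpunc x T).
Implicit Types (u v : U) (a : G) (y z p q : point) (t : set (tile R d L)).

Variable c : U -> point.
Context (s b S : R) (s0 : 0 < s) (b0 : 0 < b) (sS : s + b <= S).
Context (c_bound : forall u, enorm (c u) < b).
Context (c_local : forall u v, agree s (ptiling u) (ptiling v) -> c u = c v).

(** The vector c u points from the origin to the centre of its cell, so that
    the puncture y of u has its centre at c (u - y) + y. *)
Definition same_cell : set G :=
  [set a | c (rpunc_rng a) = c (rpunc_src a) + displacement a].

(** Read from the centre of the cell, hence the same for all the points of a
    cell ([same_cell_type]). *)
Definition cell_type u := local_patch S (ptiling u) (c u).

Definition box t p : set U := [set u | cell_type u = t /\ c u = p].

Definition bisection t p q : set G :=
  [set a | [/\ same_cell a, cell_type (rpunc_rng a) = t,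
               c (rpunc_rng a) = p & c (rpunc_src a) = q]].

Lemma cell_type_local u v : agree (S + b) (ptiling u) (ptiling v) -> cell_type u = cell_type v.
Proof.
move=> uv; have cuv : c u = c v.
  by apply: c_local; apply: agree_le uv; have := b0; have := sS; lra.
by rewrite /cell_type cuv; apply: agree_shift uv _; rewrite enormN lerD2l ltW.
Qed.

Lemma same_cell_displacement a : same_cell a ->
  displacement a = c (rpunc_rng a) - c (rpunc_src a).
Proof. by rewrite /same_cell/= => ->; rewrite addrC addKr. Qed.

Lemma same_cell_bounded a : same_cell a -> enorm (displacement a) <= b + b.
Proof.
move=> /same_cell_displacement->; rewrite (le_trans (enormD _ _))// enormN.
by rewrite lerD// ltW.
Qed.

Lemma same_cell_type a : same_cell a -> cell_type (rpunc_src a) = cell_type (rpunc_rng a).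
Proof.
move=> Ka; rewrite /cell_type /local_patch ptiling_src translateD -opprD.
by rewrite [_ + c _]addrC -Ka.
Qed.

Lemma near_arrow_centres a a' : near_arrow (s + enorm (displacement a)) a a' ->
  c (rpunc_rng a) = c (rpunc_rng a') /\ c (rpunc_src a) = c (rpunc_src a').
Proof.
move=> [aa daa]; split; apply: c_local.
  by apply: agree_le aa; rewrite lerDl enorm_ge0.
by rewrite !ptiling_src daa; apply: agree_shift aa _; rewrite enormN.
Qed.

Lemma same_cell_clopen : open same_cell /\ closed same_cell.
Proof.
apply: (locally_determined_clopen hr) => a; exists (s + enorm (displacement a)) => a' aa.
by have [rr ss] := near_arrow_centres aa; rewrite /same_cell/= rr ss; case: aa => _ ->.
Qed.

Lemma bisection_clopen t p q : open (bisection t p q) /\ closed (bisection t p q).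
Proof.
apply: (locally_determined_clopen hr) => a.
exists (Num.max (S + b) (s + enorm (displacement a))) => a' [aa daa].
have [rr ss] : c (rpunc_rng a) = c (rpunc_rng a') /\ c (rpunc_src a) = c (rpunc_src a').
  by apply: near_arrow_centres; split=> //; apply: agree_le aa; rewrite le_max lexx orbT.
have tt : cell_type (rpunc_rng a) = cell_type (rpunc_rng a').
  by apply: cell_type_local; apply: agree_le aa; rewrite le_max lexx.
by rewrite /bisection/same_cell/= rr ss tt daa.
Qed.

Lemma box_clopen t p : open (box t p) /\ closed (box t p).
Proof.
have E u v : agree (S + b) (ptiling u) (ptiling v) -> box t p u -> box t p v.
  move=> uv [<- <-]; split; first exact/esym/cell_type_local.
  by apply: c_local; apply: agree_le (esym uv); have := b0; have := sS; lra.
split; first by rewrite openE => u bu; apply/(nbhs_hullP hr); exists (S + b) => v /E; exact.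
rewrite -[box t p]setCK; apply: open_closedC; rewrite openE => u bu.
by apply/(nbhs_hullP hr); exists (S + b) => v uv /(E _ _ (esym uv)).
Qed.

Lemma same_cell_compact : compact same_cell.
Proof.
apply: (subclosed_compact same_cell_clopen.2 _ same_cell_bounded).
exact: (bounded_arrows_compact hr T_tiling T_FLC T_free).
Qed.

Lemma bisection_compact t p q : compact (bisection t p q).
Proof.
by apply: (subclosed_compact (bisection_clopen t p q).2 same_cell_compact) => a [].
Qed.

(** Around their centres u and v look alike. So the position of the origin of v
    relative to its centre is also a puncture of u relative to its own centre,
    and moving the origin of u there gives a tiling which agrees with v on a
    ball large enough to determine the centre. *)
Lemma same_type_arrow u v : cell_type u = cell_type v -> exists a,
  [/\ same_cell a, rpunc_rng a = u & c (rpunc_src a) = c v].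
Proof.
move=> uv; have bS : b <= S by have := s0; have := sS; lra.
have uy : punctures x (ptiling u) (c u - c v).
  have : punctures x (translate (ptiling v) (- c v)) (- c v).
    by apply/(puncturesD _ _ _ (ptiling_tiling v)); rewrite subrr; exact: punctures0.
  have tv : is_tiling P (translate (ptiling v) (- c v)).
    by apply: is_tiling_shift; exact: ptiling_tiling.
  move=> /(agree_punctures hr tv (esym uv)); rewrite enormN (lt_le_trans (c_bound v) bS).
  by move=> /(_ isT)/(puncturesD _ _ _ (ptiling_tiling u)); rewrite opprK addrC.
have [a [au ay]] := arrow_from T_free uy.
have cv : c (rpunc_src a) = c v.
  apply: c_local; rewrite ptiling_src au ay opprB addrC -translateD.
  rewrite -[ptiling v](translateK _ (- c v)) opprK; apply: agree_shift uv _.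
  by rewrite (le_trans _ sS)// lerD2l ltW.
by exists a; split; rewrite // /same_cell/= cv ay au addrC subrK.
Qed.

Lemma same_cell_inv a : same_cell a -> same_cell (rpunc_inv a).
Proof.
by rewrite /same_cell/= => ->; rewrite (displacement_inv T_free) addrK.
Qed.

Lemma same_cell_mul a a' : rpunc_src a = rpunc_rng a' -> same_cell a -> same_cell a' ->
  same_cell (rpunc_mul a a').
Proof.
move=> aa; rewrite /same_cell/= (displacement_mul T_free aa).
have [-> ->] := rpunc_mulP aa; rewrite aa => -> ->.
by rewrite -addrA [displacement a' + _]addrC.
Qed.

Lemma same_cell_idt u : same_cell (rpunc_idt u).
Proof. by rewrite /same_cell/= (displacement_idt T_free) addr0. Qed.

Lemma bisection_range t p q : box t p !=set0 -> box t q !=set0 ->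
  @rpunc_rng R d L P x T @` bisection t p q = box t p /\
  @rpunc_src R d L P x T @` bisection t p q = box t q.
Proof.
move=> [u0 [u0t u0p]] [v0 [v0t v0q]]; split; apply/seteqP; split.
- by move=> _ [a [Ka at_ ap aq] <-].
- move=> u [ut up]; have [|a [Ka au av]] := @same_type_arrow u v0; first by rewrite ut v0t.
  by exists a => //; split; rewrite ?au ?av.
- by move=> _ [a [Ka at_ ap aq] <-]; split; rewrite // same_cell_type.
- move=> v [vt vq]; have [|a [Ka av au]] := @same_type_arrow v u0; first by rewrite u0t vt.
  exists (rpunc_inv a) => //; split; rewrite /= ?av ?au ?u0p ?vq//.
    exact: same_cell_inv.
  by rewrite same_cell_type// av.
Qed.

Lemma bisection_displacement t p q a : bisection t p q a -> displacement a = p - q.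
Proof. by move=> [/same_cell_displacement-> _ -> ->]. Qed.

(** On [bisection t p q] the displacement is p - q, so an arrow is determined by
    its range. *)
Lemma bisection_unique t p q (W : set G) : box t p !=set0 -> box t q !=set0 ->
  W `<=` same_cell -> @rpunc_rng R d L P x T @` W = box t p ->
  @rpunc_src R d L P x T @` W = box t q -> bisection t p q = W.
Proof.
move=> tp tq WK Wp Wq.
have WV : W `<=` bisection t p q.
  move=> a Wa; have : box t p (rpunc_rng a) by rewrite -Wp; exists a.
  have : box t q (rpunc_src a) by rewrite -Wq; exists a.
  by move=> [_ aq] [at_ ap]; split=> //; exact: WK.
apply/seteqP; split=> // a Va; have [_ at_ ap _] := Va.
have : box t p (rpunc_rng a) by [].
rewrite -Wp => -[a' Wa' aa']; suff -> : a = a' by [].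
apply: arrow_eq_rng => //; rewrite (bisection_displacement Va).
by rewrite (bisection_displacement (WV _ Wa')).
Qed.

Lemma same_cell_units : gunits (same_cell : set (Rpunc x T)) = setT.
Proof. by apply/seteqP; split => // u _; exact: same_cell_idt. Qed.

(** The arrows of K with a fixed displacement y form an open set on which the
    range map is injective; it is open there because having the puncture y
    is a locally determined property of a tiling. *)
Lemma same_cell_etale : etale (same_cell : set (Rpunc x T)).
Proof.
have [oK _] := same_cell_clopen; split.
- exact: (@continuous_subspaceT G U same_cell _ (rpunc_rng_continuous hr)).
- exact: (@continuous_subspaceT G U same_cell _ (rpunc_src_continuous hr T_free)).
- exact: (@continuous_subspaceT G G same_cell _ (rpunc_inv_continuous hr T_free)).
- apply: (@continuous_subspaceW (G * G)%type G _ [set ab : G * G | rpunc_src ab.1 = rpunc_rng ab.2]);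
    last exact: (rpunc_mul_continuous hr T_free).
  by move=> ab [].
- move=> a Ka; exists (same_cell `&` [set a' | displacement a' = displacement a]).
  have [oU _] := locally_determined_clopen hr
    (@locally_determined_displacement R d L P x T [set displacement a]).
  split.
  + by [].
  + by move=> a' [].
  + by apply: open_subspaceW; apply: openI.
  + move=> a1 a2; rewrite !inE => -[_ /= d1] [_ /= d2] h; apply: arrow_eq_rng => //.
    by rewrite d1 d2.
  + move=> W WU oW; rewrite same_cell_units; apply: open_subspaceW.
    have {}oW : open (W : set G).
      rewrite (_ : W = W `&` same_cell); first by rewrite (open_setIS _ oK).
      by apply/seteqP; split => [a' Wa'|a' []//]; split=> //; have [] := WU _ Wa'.
    rewrite openE => _ [a' Wa' <-]; have /(nbhs_arrowP hr)[e eW] : nbhs a' W.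
      by apply: open_nbhs_nbhs.
    apply/(nbhs_hullP hr); exists (Num.max e (enorm (displacement a') + 1)) => v uv.
    have vy : punctures x (ptiling v) (displacement a').
      apply: (agree_punctures hr (ptiling_tiling (rpunc_rng a')) uv).
        by rewrite lt_max ltrDl ltr01 orbT.
      exact: punctures_displacement.
    have [a2 [a2v a2y]] := arrow_from T_free vy; exists a2 => //.
    apply: eW; split=> //; rewrite /= a2v; apply: agree_le uv.
    by rewrite le_max lexx.
Qed.

(** The index i runs through the finitely many types of cells, and j through the
    finitely many vectors from a point to the centre in a cell of that type. *)
Lemma same_cell_fundamental_domain : exists n (N : 'I_n -> nat)
    (F : forall i, 'I_(N i) -> set U),
  fundamental_domain (same_cell : set (Rpunc x T)) F /\ forall i j, exists t p, F i j = box t p.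
Proof.
have Sb0 : 0 < S + b by have := s0; have := b0; have := sS; lra.
have /finite_seqP[Ts0 Ts0E] : finite_set (range cell_type).
  by apply: (locally_constant_finite hr T_tiling T_FLC Sb0); exact: cell_type_local.
pose Ts := undup Ts0.
have TsE t : t \in Ts <-> exists u, cell_type u = t.
  rewrite mem_undup; split => [tT|[u <-]].
    by have : [set` Ts0] t by []; rewrite -Ts0E => -[u _ <-]; exists u.
  by have : range cell_type (cell_type u) by [exists u]; rewrite Ts0E.
have /choice[Ps PsP] : forall t, exists s : seq point,
    uniq s /\ forall p, p \in s <-> box t p !=set0.
  move=> t; have /finite_seqP[Q0 Q0E] : finite_set (c @` [set u | cell_type u = t]).
    apply: (sub_finite_set _ (locally_constant_finite hr T_tiling T_FLC s0 c_local)).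
    by move=> _ [u _ <-]; exists u.
  exists (undup Q0); split=> [|p]; first exact: undup_uniq.
  rewrite mem_undup; split => [pQ|[u [ut <-]]].
    by have : [set` Q0] p by []; rewrite -Q0E => -[u ut <-]; exists u.
  by have : (c @` [set u | cell_type u = t]) (c u) by [exists u]; rewrite Q0E.
pose tau (i : 'I_(size Ts)) := nth set0 Ts i.
pose N i := size (Ps (tau i)).
pose pos i (j : 'I_(N i)) := nth 0 (Ps (tau i)) j.
have boxN i j : box (tau i) (@pos i j) !=set0.
  by have [_ /(_ (pos i j)) h] := PsP (tau i); apply/h; rewrite mem_nth.
have tau_inj i i' : tau i = tau i' -> i = i'.
  move=> /eqP; rewrite /tau nth_uniq ?undup_uniq// => /eqP; exact: val_inj.
have pos_inj i (j j' : 'I_(N i)) : pos i j = pos i j' -> j = j'.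
  move=> /eqP; rewrite /pos nth_uniq ?(PsP _).1// => /eqP; exact: val_inj.
have tau_ex u : exists i, tau i = cell_type u.
  have uT : cell_type u \in Ts by apply/TsE; exists u.
  have iT : (index (cell_type u) Ts < size Ts)%N by rewrite index_mem.
  exists (Ordinal iT).
  by rewrite /tau/= nth_index.
have pos_ex i u : cell_type u = tau i -> exists j, pos i j = c u.
  move=> ui; have up : c u \in Ps (tau i) by apply/(PsP _).2; exists u.
  have jN : (index (c u) (Ps (tau i)) < N i)%N by rewrite index_mem.
  exists (Ordinal jN).
  by rewrite /pos/= nth_index.
exists (size Ts), N, (fun i j => box (tau i) (pos i j)); split; last first.
  by move=> i j; exists (tau i), (pos i j).
split.
- move=> i; have /TsE[u ut] : tau i \in Ts by rewrite mem_nth.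
  by have [j _] := pos_ex _ _ ut; apply: leq_ltn_trans (ltn_ord j).
- move=> i j; rewrite same_cell_units; split=> //.
  have [bo bc] := box_clopen (tau i) (pos i j).
  by split; [exact: open_subspaceW | exact: closed_subspaceW].
- move=> [i j] [i' j'] _ _ /= [u [[ui uj] [ui' uj']]].
  have eqi : i = i' by apply: tau_inj; rewrite -ui -ui'.
  by rewrite -eqi in j' ui' uj' *; congr existT; apply: pos_inj; rewrite -uj -uj'.
- rewrite same_cell_units; apply/seteqP; split => // u _.
  have [i iu] := tau_ex u; have [j ju] := pos_ex _ _ (esym iu).
  by exists i => //; exists j.
- exists (fun i j k => bisection (tau i) (pos i j) (pos i k)); split.
  + move=> i j k; split.
      split.
      * by move=> a [].
      * exact: bisection_compact.
      * exact: open_subspaceW (bisection_clopen _ _ _).1.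
      * split=> a a'; rewrite !inE => Va Va' aa'.
          by apply: arrow_eq_rng aa' _; rewrite (bisection_displacement Va) (bisection_displacement Va').
        by apply: arrow_eq_src aa' _; rewrite (bisection_displacement Va) (bisection_displacement Va').
      * exact: bisection_range.
    by move=> W [WK _ _ _ [W1 W2]]; exact: bisection_unique.
  + move=> [i [j k]] [i' [j' k']] _ _ /= [a [[_ ai aj ak] [_ ai' aj' ak']]].
    have eqi : i = i' by apply: tau_inj; rewrite -ai -ai'.
    rewrite -eqi in j' k' ai' aj' ak' *; congr existT; congr pair; apply: pos_inj.
      by rewrite -aj -aj'.
    by rewrite -ak -ak'.
  + apply/seteqP; split=> [a [i _ [j _ [k _ []]]]//|a Ka].
    have [i ia] := tau_ex (rpunc_rng a); have [j ja] := pos_ex _ _ (esym ia).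
    have [|k ka] := pos_ex i (rpunc_src a); first by rewrite same_cell_type.
    by exists i => //; exists j => //; exists k.
Qed.

Lemma same_cell_elementary : elementary (same_cell : set (Rpunc x T)).
Proof.
split.
- split=> [a a' Ka Ka' aa'|a]; first exact: same_cell_mul.
  exact: same_cell_inv.
- exact: same_cell_compact.
- exact/subspace_hausdorff/metric_hausdorff.
- exact: same_cell_etale.
- split; first exact: same_cell_units.
  by have [n [N [F [h _]]]] := same_cell_fundamental_domain; exists n, N, F.
Qed.

(** Two tilings of a box have their centres at the same vector p, of norm less
    than b, and agree on the ball of radius S about it. *)
Lemma box_diam (eta : R) t p : eta^-1 < S - b -> 1 < S - b -> 0 < eta ->
  diam (box t p) < eta.
Proof.
move=> etaS S1 eta0; have Sb0 : 0 < S - b by rewrite (lt_trans _ S1).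
have key u v : box t p u -> box t p v -> mdist u v <= (S - b)^-1.
  move=> [ut up] [vt vp]; apply: eps_close_agree => //.
  have : agree S (translate (ptiling u) (- c u)) (translate (ptiling v) (- c v)).
    exact: etrans ut (esym vt).
  rewrite up vp => uv; rewrite -[ptiling u](translateK _ (- p)) -[ptiling v](translateK _ (- p)).
  by apply: agree_shift uv _; rewrite opprK -up; have := c_bound u; lra.
apply: (@le_lt_trans _ _ (S - b)^-1); last by rewrite -[ltRHS]invrK ltf_pV2 ?posrE ?invr_gt0.
rewrite /diam; have [[z [u ub [v vb uvz]]]|/set0P/negP/negPn/eqP->] := pselect
    ([set mdist u v | u in box t p & v in box t p] !=set0).
  apply: ge_sup; first by exists z, u => //; exists v.
  by move=> _ [u' u'b [v' v'b <-]]; exact: key.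
by rewrite sup0 invr_ge0 ltW.
Qed.

End cells.

(** * Invariance *)

Section invariance.
Context {R : realType} {d : nat} {L : Type}.
Variables (P : prototile_set R d L) (x : puncturing P) (T : set (tile R d L)).
Context (r rho : R) (hr : radii x r rho).
Context (T_tiling : is_tiling P T) (T_FLC : FLC T) (T_free : nonperiodic_hull P T).
Local Notation point := 'rV[R]_d.
Local Notation U := (punctured_hull x T).
Local Notation G := (rpunc x T).

(** Arrows of source u correspond, through the opposite of the displacement, to
    the punctures of u; those of K to the cell of the origin, and those of CK to
    punctures within distance m of the cell, where m bounds the displacements in
    C. The cells are made so large that [voronoi_layers] applies with a number K
    of layers exceeding the number of colours divided by e. *)
Lemma voronoi_cells_invariant (C : set G) (e : R) : compact C -> 0 < e ->
  exists (c : U -> point) (s b : R),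
    [/\ 0 < s, 0 < b, forall u, enorm (c u) < b,
        forall u v, agree s (ptiling u) (ptiling v) -> c u = c v &
        almost_invariant (C : set (Rpunc x T)) e (same_cell c)].
Proof.
move=> /(compact_displacement_bounded hr)[m m0 Cm] e0; have [r0 rho0 _] := hr.
have [I [col colP]] := @grid_colouring R d (4 * rho) r r0.
pose K := (Num.truncn (#|I|%:R / e)).+1.
have KI : #|I|%:R / e < K%:R.
  by have /truncn_itv/andP[] := divr_ge0 (ler0n R #|I|) (ltW e0).
(* Centres will be 2 q apart, so that the cells contain balls of radius q. *)
pose q := (m + 4 * rho) * (2 * K.+1%:R) + 1.
have q0 : 0 < q by rewrite ltr_wpDl// !mulr_ge0// addr_ge0// mulr_ge0// ltW.
have qq0 : 0 < 2 * q by rewrite mulr_gt0.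
have [D [c [s [s0 Dsp Dshift cD cloc]]]] := centres hr T_tiling T_FLC T_free qq0.
exists c, s, (2 * q); split=> //; first by move=> u; have [_ ? _] := cD u.
move=> u /=.
have tu := ptiling_tiling u.
have arrow_at y : exists a : G, punctures x (ptiling u) y ->
    rpunc_src a = u /\ displacement a = - y.
  have [uy|nuy] := pselect (punctures x (ptiling u) y); last by exists (rpunc_idt u).
  have [a [au ay]] := arrow_from T_free uy; exists (rpunc_inv a) => _ /=.
  by rewrite au (displacement_inv T_free) ay.
have /choice[arr arrP] := arrow_at.
pose S := [set y | punctures x (ptiling u) y /\ same_cell c (arr y)].
have posP (a : G) : rpunc_src a = u -> punctures x (ptiling u) (- displacement a).
  by move=> au; have := punctures_displacement (rpunc_inv a); rewrite /= au (displacement_inv T_free).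
have arr_pos (a : G) : rpunc_src a = u -> arr (- displacement a) = a.
  move=> au; have [au' ad] := arrP _ (posP a au); apply: arrow_eq_src.
    by rewrite au' au.
  by rewrite ad opprK.
have shift y : punctures x (ptiling u) y ->
    ptiling (rpunc_rng (arr y)) = translate (ptiling u) (- y).
  by move=> uy; have [au ad] := arrP y uy; rewrite ptiling_rng au ad.
have cell_at y : punctures x (ptiling u) y ->
    (same_cell c (arr y) <-> c (rpunc_rng (arr y)) + y = c u).
  move=> uy; have [au ad] := arrP y uy; rewrite /same_cell/= au ad.
  by split=> [->|<-]; rewrite ?subrK ?addrK.
have [|||||f] := @voronoi_layers R d (punctures x (ptiling u)) (D u) S (c u) q rho m K m0 rho0.
- by move=> z; have [y uy yz] := punctures_cover hr z tu; exists y.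
- move=> z Dz cz; rewrite leNgt; apply/negP => h; apply: cz.
  by apply: (Dsp u) => //; have [] := cD u.
- move=> y [uy /(cell_at y uy) cy] z Dz; have [_ _ cmin] := cD (rpunc_rng (arr y)).
  have -> : y - c u = - c (rpunc_rng (arr y)) by rewrite -cy opprD addrCA subrr addr0.
  rewrite enormN enormB; apply: cmin.
  by apply/(Dshift _ _ _ (shift y uy)); rewrite subrK.
- move=> y uy near; split=> //; apply/(cell_at y uy); apply: contrapT => ne.
  have [Dc _ cmin] := cD (rpunc_rng (arr y)).
  have := near (c (rpunc_rng (arr y)) + y); rewrite -(Dshift _ _ _ (shift y uy)).
  move=> /(_ Dc (nesym ne)); rewrite opprD addrCA subrr addr0 enormN ltNge => /negP; apply.
  rewrite enormB; apply: cmin; apply/(Dshift _ _ _ (shift y uy)); rewrite subrK.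
  by have [] := cD u.
- by rewrite /q ltrDl.
set B := [set z | _]; move=> /= [fS finj].
set Au := fiber _ u.
set E := fiber _ u `\` Au.
have AuS a : Au a -> S (- displacement a).
  by move=> [Ka au]; split; [exact: posP|rewrite arr_pos].
have SAu y : S y -> Au (arr y).
  by move=> [uy Ky]; split=> //; have [] := arrP y uy.
have EB a : E a -> rpunc_src a = u /\ B (- displacement a).
  move=> [[[g [k [Cg Kk /= gk ->]]] /= au] nAu].
  have ka : rpunc_src k = u by have [_ <-] := rpunc_mulP gk.
  split=> //; split; first exact: posP.
  - by move=> [_]; rewrite arr_pos// => Ka; apply: nAu.
  - exists (- displacement k); first exact: AuS.
    rewrite (displacement_mul T_free gk) opprK opprD subrK enormN; exact: Cm.
have disp_inj (A : set G) : A `<=` [set a | rpunc_src a = u] ->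
    set_inj A (fun a => - displacement a).
  move=> Au' a a'; rewrite !inE => /Au' /= au /Au' /= au' /oppr_inj aa'.
  by apply: arrow_eq_src => //; rewrite au au'.
have fin (A : set G) (bd : R) : A `<=` [set a | rpunc_src a = u] ->
    (forall a, A a -> enorm (displacement a) <= bd) -> finite_set A.
  move=> Au' Abd; apply: (finite_set_inj (disp_inj A Au') _ (punctures_finite hr bd tu)).
  move=> _ [a Aa <-]; split; first exact/posP/Au'.
  by rewrite enormN Abd.
have cb v : enorm (c v) < 2 * q by have [] := cD v.
have fAu : finite_set Au.
  apply: (fin _ (2 * q + 2 * q)); first by move=> a [].
  by move=> a [Ka _]; exact: (same_cell_bounded cb Ka).
have fE : finite_set E.
  apply: (fin _ (m + (2 * q + 2 * q))); first by move=> a [[]].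
  move=> a [[[g [k [Cg Kk /= gk ->]]] /= au] _].
  rewrite (displacement_mul T_free gk) (le_trans (enormD _ _))// lerD ?Cm//.
  exact: (same_cell_bounded cb Kk).
have Au0 : Au !=set0.
  by exists (rpunc_idt u); split => //; exact: (same_cell_idt T_free).
split=> //.
have count := @card_boundary _ _ I E Au K (fun a k => arr (f (- displacement a) k))
  (fun a => col (- displacement a)) fE fAu.
have {count} : (#|` fset_set E| * K <= #|` fset_set Au| * #|I|)%N.
  apply: count.
    by move=> a k /EB[_ Ba] kK; apply/SAu/fS.
  move=> a a' k k' Ea Ea' kK kK' faa' caa'.
  have [au Ba] := EB _ Ea; have [au' Ba'] := EB _ Ea'.
  have [uf _] := fS _ _ Ba kK; have [uf' _] := fS _ _ Ba' kK'.
  have [_ d1] := arrP _ uf; have [_ d2] := arrP _ uf'.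
  have ff : f (- displacement a) k = f (- displacement a') k'.
    by apply: oppr_inj; rewrite -d1 -d2 faa'.
  have [-> aa] := finj _ _ _ _ Ba Ba' kK kK' ff; split=> //.
  apply: (disp_inj [set a | rpunc_src a = u]); rewrite ?inE//=.
  apply: (punctures_spaced hr tu); [exact: posP|exact: posP|].
  exact: colP aa caa'.
have A1 : (0 < #|` fset_set Au|)%N.
  rewrite cardfs_gt0; apply/fset0Pn; have [a Aa] := Au0; exists a.
  by rewrite in_fset_set// inE.
rewrite -(ler_nat R) !natrM => h.
rewrite ltr_pdivrMr ?ltr0n// -(ltr_pM2r (x := K%:R)) ?ltr0n//.
apply: (le_lt_trans h); rewrite [e * _]mulrC -mulrA ltr_pM2l ?ltr0n//.
by rewrite mulrC -ltr_pdivrMr.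
Qed.

(** One subgroupoid serves for all eta: only the radius S of the patches which
    define its fundamental domain depends on eta. *)
Theorem almost_finite_small_domains (C : set (Rpunc x T)) (e eta : R) :
  compact C -> 0 < e -> 0 < eta ->
  exists K : set (Rpunc x T),
    [/\ elementary K, almost_invariant C e K &
        exists n (N : 'I_n -> nat) (F : forall i, 'I_(N i) -> set (punctured_hull x T)),
          fundamental_domain K F /\ forall i j, diam (F i j) < eta].
Proof.
move=> cC e0 eta0; have [c [s [b [s0 b0 cb cloc inv]]]] := voronoi_cells_invariant cC e0.
(* S - b exceeds both 1 and eta^-1. *)
pose S := s + b + 2 + eta^-1.
have ei : 0 < eta^-1 by rewrite invr_gt0.
have sS : s + b <= S by rewrite /S; lra.
exists (same_cell c); split => //.
  exact: (same_cell_elementary hr T_tiling T_FLC T_free s0 b0 sS cb cloc).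
have [n [N [F [fF Fbox]]]] :=
  same_cell_fundamental_domain hr T_tiling T_FLC T_free s0 b0 sS cb cloc.
exists n, N, F; split=> // i j; have [t [p ->]] := Fbox i j.
by apply: (box_diam cb) => //; rewrite /S; lra.
Qed.

Lemma compact_open_bisections_cover (a : Rpunc x T) :
  exists W, [/\ compact W, open W, gset W & W a].
Proof.
pose W := [set b : G | [set displacement a] (displacement b)].
have [oW cW] := locally_determined_clopen hr
  (@locally_determined_displacement R d L P x T [set displacement a]).
have kW : compact W.
  apply: (subclosed_compact cW (bounded_arrows_compact hr T_tiling T_FLC T_free
    (b := enorm (displacement a)))).
  by move=> b /= ->.
exists W; split=> //.
split=> b b'; rewrite !inE => /= d1 d2 h.
  by apply: arrow_eq_rng h _; rewrite d1 d2.
by apply: arrow_eq_src h _; rewrite d1 d2.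
Qed.

End invariance.

(** The hypothesis concerns every set of tiles with an inhabited hull, and a
    tiling of the hull of T belongs to its own hull. *)
Lemma aperiodic_nonperiodic_hull (R : realType) (d : nat) (L : Type)
  (P : prototile_set R d L) T : aperiodic P T -> nonperiodic_hull P T.
Proof.
move=> ap T' [tT' _] v; apply: (ap T').
suff h : hull P T' T' by exists T'; rewrite inE.
by split=> // e e0; exists 0; rewrite translate0 tdistxx.
Qed.

Unset Implicit Arguments.

Theorem lemma7p4 (R : realType) (d : nat) (L : Type)
    (P : prototile_set R d L) (x : puncturing P) (T : set (tile R d L))
    (T_tiling : is_tiling P T) (T_aperiodic : aperiodic P T)
    (T_repetitive : repetitive T) (T_FLC : FLC T) :
  almost_finite (Rpunc x T) R /\
  forall (C : set (Rpunc x T)) (e eta : R), compact C -> 0 < e -> 0 < eta ->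
    exists K : set (Rpunc x T),
      [/\ elementary K, almost_invariant C e K &
          exists n (N : 'I_n -> nat)
                 (F : forall i, 'I_(N i) -> set (punctured_hull x T)),
            fundamental_domain K F /\
            forall i j, diam (F i j) < eta].
Proof.
have [r [rho hr]] := radii_exist x.
have T_free := aperiodic_nonperiodic_hull T_aperiodic.
have small := almost_finite_small_domains hr T_tiling T_FLC T_free.
split; last exact: small.
split; first exact: (compact_open_bisections_cover hr T_tiling T_FLC T_free).
move=> C e cC e0; have [K [elK inv _]] := small C e 1 cC e0 ltr01.
by exists K.
Qed.
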